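(* Let $\mathbf{L}\in Q(\mathbb{B}^n)$ and let $F:\mathbb{B}^n\to\mathbb{C}$ be analytic. If there exist $p\in\mathbb{Z}_+$, $d\in(0,1]$ and $\eta\in(0,d)$ such that for each $z^0\in\mathbb{B}^n$ there are $R=(r_1,\dots,r_n)$ with $r_j=r_j(d,z^0)\in(\eta,d)$, $j\in\{1,\dots,n\}$, and $k^0=k^0(d,z^0)\in\mathbb{Z}_+$ with $k^0\le p$ for which $P_{k^0}$ is a dominating polynomial, on the skeleton $\mathbb{T}^n(z^0,R/\mathbf{L}(z^0))$, in the power series expansion of $F$ about $z^0$, then $F$ has bounded $\mathbf{L}$-index in joint variables.
   Context: $\mathbb{R}_+=[0,\infty)$, $\mathbb{Z}_+=\{0,1,2,\dots\}$. $|\cdot|$ is the Euclidean norm on $\mathbb{C}^n$ (and on $\mathbb{R}^n$); $\mathbb{B}^n=\{z\in\mathbb{C}^n:|z|<1\}$. For $K\in\mathbb{Z}^n_+$: $\|K\|=k_1+\dots+k_n$, $K!=k_1!\cdots k_n!$, $A^K=a_1^{k_1}\cdots a_n^{k_n}$, and $F^{(K)}=\partial^{\|K\|}F/\partial z_1^{k_1}\cdots\partial z_n^{k_n}$. Quotients $A/B$ of vectors are componentwise. For $R\in\mathbb{R}^n_+$: $\mathbb{D}^n[z^0,R]=\{z:|z_j-z^0_j|\le r_j\ \forall j\}$, $\mathbb{T}^n(z^0,R)=\{z:|z_j-z^0_j|=r_j\ \forall j\}$. Dominating polynomial: for $z^0\in\mathbb{B}^n$ expand $F(z)=\sum_{k=0}^\infty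 P_k(z-z^0)$, $P_k(z-z^0)=\sum_{\|J\|=k}b_J(z-z^0)^J$, $b_J=F^{(J)}(z^0)/J!$. The polynomial $P_{k^0}$ is called a dominating polynomial in this expansion on $\mathbb{T}^n(z^0,R)$ if for every $z\in\mathbb{T}^n(z^0,R)$: $\left|\sum_{k\ne k^0}P_k(z-z^0)\right|\le\frac12\max\{|b_J|R^J:\|J\|=k^0\}$. Fix a constant $\beta>\sqrt n$. Throughout, $\mathbf{L}(z)=(l_1(z),\dots,l_n(z))$, where each $l_j:\mathbb{B}^n\to\mathbb{R}_+$ is continuous and $l_j(z)>\beta/(1-|z|)$ for all $z\in\mathbb{B}^n$. (Then $\mathbb{D}^n[z^0,R/\mathbf{L}(z^0)]\subset\mathbb{B}^n$ whenever $z^0\in\mathbb{B}^n$, $|R|\le\beta$.) $Q(\mathbb{B}^n)$ is the class of such $\mathbf{L}$ satisfying, for all $R\in\mathbb{R}^n_+$ with $|R|\le\beta$ and all $j$, $0<\lambda_{1,j}(R)\le\lambda_{2,j}(R)<\infty$, where $\lambda_{1,j}(R)$ and $\lambda_{2,j}(R)$ are respectively the infimum and the supremum of $l_j(z)/l_j(z^0)$ over all $z^0\in\mathbb{B}^n$ and $z\in\mathbb{D}^n[z^0,R/\mathbf{L}(z^0)]$. An analytic $F:\mathbb{B}^n\to\mathbb{C}$ is of bounded $\mathbf{L}$-index in joint variables if there is $m\in\mathbb{Z}_+$ such that for all $z\in\mathbb{B}^n$ and $J\in\mathbb{Z}^n_+$: $\frac{|F^{(J)}(z)|}{J!\mathbf{L}^J(z)}\le\max\{\frac{|F^{(K)}(z)|}{K!\mathbf{L}^K(z)}:K\in\mathbb{Z}^n_+,\|K\|\le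 m\}$. *)

(* Defs.v *)
From mathcomp Require Import all_boot all_order all_algebra.
From mathcomp Require Import all_classical all_reals all_analysis.
From mathcomp Require Import complex.

Set Implicit Arguments.
Unset Strict Implicit.
Unset Printing Implicit Defensive.

Import Order.TTheory GRing.Theory Num.Theory.
Import numFieldNormedType.Exports.

Local Open Scope classical_set_scope.
Local Open Scope ring_scope.

(* The complex numbers, packed as a numFieldType: MathComp-Analysis attaches
   its topology and norm to packed number fields, not to the bare type R[i]. *)
Definition Cx (R : realType) : numFieldType := R[i]%C.

(* Real-valued modulus; the generic `|z| takes its values in R[i]. *)
Definition cmod (R : realType) (z : Cx R) : R := ComplexField.Normc.normc z.

Section MultiIndex.
Variable n : nat.

Definition mdeg (K : 'I_n -> nat) : nat := (\sum_j K j)%N.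

Definition mfact (K : 'I_n -> nat) : nat := (\prod_j (K j)`!)%N.

Definition mpow (T : comNzRingType) (a : 'I_n -> T) (K : 'I_n -> nat) : T :=
  \prod_j a j ^+ K j.

(* Multi-indices with all entries at most k form a finite type, which contains
   every multi-index of degree at most k. *)
Definition midx (k : nat) (J : {ffun 'I_n -> 'I_k.+1}) : 'I_n -> nat :=
  fun j => J j.

Definition hpoly (T : comNzRingType) (a : ('I_n -> nat) -> T) (k : nat)
    (w : 'I_n -> T) : T :=
  \sum_(J : {ffun 'I_n -> 'I_k.+1} | mdeg (midx J) == k)
     a (midx J) * mpow w (midx J).

End MultiIndex.

Section Ball.
Variables (R : realType) (n : nat).
Local Notation C := (Cx R).
Implicit Types (z w : 'rV[C]_n) (r : 'I_n -> R) (K J : 'I_n -> nat).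

(* Row vectors carry the sup norm in the library, hence the explicit
   Euclidean norms. *)
Definition enormR r : R := Num.sqrt (\sum_j r j ^+ 2).

Definition enormC z : R := enormR (fun j => cmod (z 0 j)).

Definition unit_ball : set 'rV[C]_n := [set z | enormC z < 1].

Definition polydisc (z0 : 'rV[C]_n) r : set 'rV[C]_n :=
  [set z | forall j, cmod (z 0 j - z0 0 j) <= r j].

Definition skeleton (z0 : 'rV[C]_n) r : set 'rV[C]_n :=
  [set z | forall j, cmod (z 0 j - z0 0 j) = r j].

(* Functions on the ball are total functions on C^n whose values off the ball
   are never used.  Analyticity is local representability by an absolutely
   convergent power series, its terms grouped by degree. *)
Definition analytic_on_ball (F : 'rV[C]_n -> C) : Prop :=
  forall z0, unit_ball z0 ->
  exists (a : ('I_n -> nat) -> C) (rho : R), 0 < rho /\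
    forall z, (forall j, cmod (z 0 j - z0 0 j) < rho) ->
      cvgn (series (fun k => hpoly (fun J => cmod (a J)) k
                               (fun j => cmod ((z - z0) 0 j)))) /\
      series (fun k => hpoly a k ((z - z0) 0)) @ \oo --> F z.

Definition partial (j : 'I_n) (F : 'rV[C]_n -> C) : 'rV[C]_n -> C :=
  fun z => 'D_(delta_mx 0 j) F z.

Definition mderiv (K : 'I_n -> nat) (F : 'rV[C]_n -> C) : 'rV[C]_n -> C :=
  foldr (fun j G => iter (K j) (partial j) G) F (enum 'I_n).

Definition taylor_coef (F : 'rV[C]_n -> C) (z0 : 'rV[C]_n) J : C :=
  mderiv J F z0 / (mfact J)%:R.

Definition dominating (F : 'rV[C]_n -> C) (z0 : 'rV[C]_n) r (k0 : nat) : Prop :=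
  let b := taylor_coef F z0 in
  forall z, skeleton z0 r z ->
  exists s : C,
    series (fun k => if k == k0 then 0 else hpoly b k ((z - z0) 0)) @ \oo --> s
    /\ cmod s <= 2^-1 *
         \big[Num.max/0]_(J : {ffun 'I_n -> 'I_k0.+1} | mdeg (midx J) == k0)
            (cmod (b (midx J)) * mpow r (midx J)).

Definition ratios (L : 'rV[C]_n -> 'I_n -> R) (j : 'I_n) r : set R :=
  [set q | exists z0 z, [/\ unit_ball z0,
     polydisc z0 (fun i => r i / L z0 i) z & q = L z j / L z0 j]].

Definition lambda1 (L : 'rV[C]_n -> 'I_n -> R) (j : 'I_n) r : \bar R :=
  ereal_inf (EFin @` ratios L j r).

Definition lambda2 (L : 'rV[C]_n -> 'I_n -> R) (j : 'I_n) r : \bar R :=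
  ereal_sup (EFin @` ratios L j r).

Definition classQ (beta : R) (L : 'rV[C]_n -> 'I_n -> R) : Prop :=
  [/\ forall j, {within unit_ball, continuous (fun z => L z j)},
      forall j z, unit_ball z -> 0 <= L z j,
      forall j z, unit_ball z -> beta / (1 - enormC z) < L z j &
      forall r, (forall i, 0 <= r i) -> enormR r <= beta ->
        forall j, (0 < lambda1 L j r)%E /\ (lambda1 L j r <= lambda2 L j r)%E
                  /\ (lambda2 L j r < +oo)%E].

(* |F^(K)(z)| / (K! L^K(z)) *)
Definition index_term (L : 'rV[C]_n -> 'I_n -> R) (F : 'rV[C]_n -> C)
    (z : 'rV[C]_n) K : R :=
  cmod (mderiv K F z) / ((mfact K)%:R * mpow (L z) K).

Definition bounded_L_index (L : 'rV[C]_n -> 'I_n -> R) (F : 'rV[C]_n -> C)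
    : Prop :=
  exists m : nat, forall z, unit_ball z -> forall J,
    index_term L F z J <=
      \big[Num.max/0]_(K : {ffun 'I_n -> 'I_m.+1} | (mdeg (midx K) <= m)%N)
         index_term L F z (midx K).

End Ball.

(* Main.v *)
Require Import Defs.
From mathcomp Require Import all_boot all_order all_algebra.
From mathcomp Require Import all_classical all_reals all_analysis.
From mathcomp Require Import complex ring lra.
From mathcomp Require cyclic separable cyclotomic.

(** Write [b z J] for the Taylor coefficients of F at z, and s for
    beta / sqrt n, which exceeds 1.

    If the homogeneous part of degree k0 dominates at z on the skeleton of radii
    r / L(z), then F minus this part is bounded on the skeleton by half of the
    largest |b z K| (r / L(z))^K with ||K|| = k0. Cauchy's inequality for the
    difference bounds every |b z J| (r / L(z))^J by that maximum. Since
    eta < r_j < 1 and k0 <= p, the coefficients of degree at most p control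
    all of them: |b z J| / L(z)^J is at most eta^(- ||J||) times the largest
    |b z K| / L(z)^K with ||K|| <= p ([dominating_coef_bound],
    [low_coefs_control]).

    The factor eta^(- ||J||) grows with ||J||, so this alone does not bound the
    index. It does bound F on a polydisc about z of radii proportional to
    1 / L(z), and Cauchy's inequality at a nearby point z' then bounds the
    coefficients of degree at most p at z' by a fixed multiple of those at z
    ([growth_near], [coef_bound_step]). In the class Q the weight L is comparable
    to L(z0) on the polydisc about z0 with radii s / L(z0), so a number of such
    steps independent of z0 reaches every point of it. Hence F is at most
    a constant G times the largest |b z0 K| / L(z0)^K with ||K|| <= p on this
    polydisc, and Cauchy's inequality there gives
    |b z0 J| / L(z0)^J <= G s^(- ||J||) times that maximum ([coef_decay]). As
    s > 1, the constant disappears once ||J|| is large, uniformly in z0.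

    Cauchy's inequality and the convergence of Taylor series on polydiscs in the
    ball are obtained from local power series without integration. On a complex
    line, F has a second-order Taylor expansion at each point, which suffices for
    the maximum principle ([max_principle]); dividing by t^m gives the Schwarz
    lemma ([schwarz]). Averaging over roots of unity isolates one coefficient
    ([cauchy_bound]), and the Schwarz lemma for the Taylor remainder gives
    convergence ([taylor_at1]). A second average, over a torus, separates the
    monomials of a homogeneous part ([poly_coef_bound], [cauchy_estimate]).
    Finally, termwise differentiation identifies the iterated partial derivatives
    with the coefficients of a local expansion ([taylor_coef_power_series]). *)

Set Implicit Arguments.
Unset Strict Implicit.
Unset Printing Implicit Defensive.

Import Order.TTheory GRing.Theory Num.Theory.
Import numFieldNormedType.Exports.

Local Open Scope classical_set_scope.
Local Open Scope ring_scope.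

(** * The complex modulus and limits in terms of it *)

Section Modulus.
Variable R : realType.
Local Notation C := (Cx R).
Implicit Types (x y z : C) (r : R).

Definition ofreal r : C := (r%:C)%C.

Lemma normE z : `|z| = ofreal (cmod z).
Proof. by []. Qed.

Lemma cmodM x y : cmod (x * y) = cmod x * cmod y.
Proof. exact: (ComplexField.Normc.normcM (x : R[i]%C) y). Qed.

Lemma cmodV x : cmod x^-1 = (cmod x)^-1.
Proof. exact: (ComplexField.Normc.normcV (x : R[i]%C)). Qed.

Lemma cmodf x y : cmod (x / y) = cmod x / cmod y.
Proof. by rewrite cmodM cmodV. Qed.

Lemma cmodD x y : cmod (x + y) <= cmod x + cmod y.
Proof. exact: (le_normcD (x : R[i]%C) y). Qed.

Lemma cmodN x : cmod (- x) = cmod x.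
Proof. exact: (normcN (x : R[i]%C)). Qed.

Lemma cmodB x y : cmod (x - y) <= cmod x + cmod y.
Proof. by rewrite -(cmodN y); exact: cmodD. Qed.

Lemma cmod_distC x y : cmod (x - y) = cmod (y - x).
Proof. by rewrite -cmodN opprB. Qed.

Lemma cmod_dist x y : `|cmod x - cmod y| <= cmod (x - y) :> R.
Proof.
have := cmodD (x - y) y; have := cmodD (y - x) x.
by rewrite !subrK cmod_distC ler_norml => *; apply/andP; split; lra.
Qed.

Lemma cmod0 : cmod (0 : C) = 0.
Proof. exact: ComplexField.Normc.normc0. Qed.

Lemma cmod1 : cmod (1 : C) = 1.
Proof. exact: ComplexField.Normc.normc1. Qed.

Lemma cmod_ge0 x : 0 <= cmod x.
Proof. by case: x => a b; exact: sqrtr_ge0. Qed.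

Lemma cmod_eq0 x : (cmod x == 0) = (x == 0).
Proof.
apply/eqP/eqP => [/(@ComplexField.Normc.eq0_normc R)//|->]; exact: cmod0.
Qed.

Lemma cmod_gt0 x : (0 < cmod x) = (x != 0).
Proof. by rewrite lt0r cmod_eq0 cmod_ge0 andbT. Qed.

Lemma cmodX x n : cmod (x ^+ n) = cmod x ^+ n.
Proof. by elim: n => [|n IH]; rewrite ?expr0 ?cmod1// !exprS cmodM IH. Qed.

Lemma cmod_ofreal r : cmod (ofreal r) = `|r|.
Proof. by rewrite /cmod /ofreal /= expr0n addr0 sqrtr_sqr. Qed.

Lemma sqr_cmod (a b : R) : cmod (a +i* b : C)%C ^+ 2 = a ^+ 2 + b ^+ 2.
Proof. by rewrite /cmod /= sqr_sqrtr// addr_ge0 ?sqr_ge0. Qed.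

Lemma cmod_le_sqr (a b s : R) : 0 <= s ->
  (cmod (a +i* b : C)%C <= s) = (a ^+ 2 + b ^+ 2 <= s ^+ 2).
Proof. by move=> s0; rewrite -sqr_cmod ler_pXn2r ?nnegrE ?cmod_ge0. Qed.

Lemma cmod_sum I (s : seq I) (P : pred I) (f : I -> C) :
  cmod (\sum_(i <- s | P i) f i) <= \sum_(i <- s | P i) cmod (f i).
Proof.
elim/big_rec2 : _ => [|i u v _ h]; first by rewrite cmod0.
by rewrite (le_trans (cmodD _ _))// lerD.
Qed.

Lemma cmod_prod I (s : seq I) (P : pred I) (f : I -> C) :
  cmod (\prod_(i <- s | P i) f i) = \prod_(i <- s | P i) cmod (f i).
Proof. exact: (big_morph (@cmod R) cmodM cmod1). Qed.

Lemma cmod_nat k : cmod (k%:R : C) = k%:R.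
Proof.
have -> : (k%:R : C) = ofreal k%:R by rewrite /ofreal rmorph_nat.
by rewrite cmod_ofreal ger0_norm.
Qed.

Lemma ofrealD r s : ofreal (r + s) = ofreal r + ofreal s.
Proof. exact: (rmorphD (real_complex R)). Qed.

Lemma ltC_ofreal r s : (ofreal r < ofreal s) = (r < s).
Proof. exact: ltcR. Qed.

Lemma gt0_ofreal (e : C) : 0 < e -> exists2 r, 0 < r & e = ofreal r.
Proof.
case: e => a b; rewrite ltcE /= => /andP[/eqP-> a0].
by exists a.
Qed.

Lemma cvgC (u : nat -> C) (l : C) :
  u @ \oo --> l <->
  (forall e : R, 0 < e -> exists N, forall m, (N <= m)%N -> cmod (u m - l) < e).
Proof.
split=> [/cvgrPdist_lt h e e0|h].
  have /h[N _ hN] : 0 < ofreal e by rewrite -[0]/(ofreal 0) ltC_ofreal.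
  exists N => m Nm; have := hN m Nm.
  by rewrite /= normE ltC_ofreal cmod_distC.
apply/cvgrPdist_lt => _ /gt0_ofreal[e e0 ->].
have [N hN] := h e e0.
by exists N => // m /= Nm; rewrite normE ltC_ofreal cmod_distC; exact: hN.
Qed.

End Modulus.
#[export] Hint Extern 0 (is_true (0 <= cmod _)) => exact: cmod_ge0 : core.

Section Limits.
Variable R : realType.
Local Notation C := (Cx R).

(** The shape of a difference quotient limit: [u] and [v] are the partial sums of
a series at two points, and [w] those of the differentiated series, which
have one term fewer. *)
Lemma lim_remainder_le (u v w : nat -> C) (lu lv lw h : C) (B : R) :
  u @ \oo --> lu -> v @ \oo --> lv -> w @ \oo --> lw ->
  (forall m, cmod (u m.+1 - v m.+1 - h * w m) <= B) ->
  cmod (lu - lv - h * lw) <= B.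
Proof.
move=> /cvgC ul /cvgC vl /cvgC wl uvw; apply/ler_addgt0Pr => e e0.
have c0 : 0 < 2 + cmod h by rewrite ltr_wpDr.
have e2 : 0 < e / (2 + cmod h) by rewrite divr_gt0.
have [N1 h1] := ul _ e2.
have [N2 h2] := vl _ e2; have [N3 h3] := wl _ e2.
set m := maxn N1 (maxn N2 N3).
have m1 : (N1 <= m.+1)%N by rewrite leqW// leq_maxl.
have m2 : (N2 <= m.+1)%N by rewrite leqW// /m leq_max leq_maxl orbT.
have m3 : (N3 <= m)%N by rewrite /m leq_max leq_maxr orbT.
have := uvw m; have := h1 _ m1; have := h2 _ m2; have := h3 _ m3.
set q := e / _ in e2 * => hw hv hu huvw.
have -> : lu - lv - h * lw = (u m.+1 - v m.+1 - h * w m)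
  - (u m.+1 - lu) + (v m.+1 - lv) + h * (w m - lw) by ring.
have qE : (2 + cmod h) * q = e by rewrite mulrC divfK// gt_eqF.
have t1 := cmodD ((u m.+1 - v m.+1 - h * w m) - (u m.+1 - lu) + (v m.+1 - lv))
  (h * (w m - lw)).
have t2 := cmodD ((u m.+1 - v m.+1 - h * w m) - (u m.+1 - lu)) (v m.+1 - lv).
have t3 := cmodB (u m.+1 - v m.+1 - h * w m) (u m.+1 - lu).
have : cmod h * cmod (w m - lw) <= cmod h * q by rewrite ler_wpM2l// ltW.
rewrite -cmodM; lra.
Qed.

Lemma cmod_lim_dist_le (u : nat -> C) (l s : C) (B : R) m0 :
  u @ \oo --> l -> (forall m, (m0 <= m)%N -> cmod (u m - s) <= B) ->
  cmod (l - s) <= B.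
Proof.
move=> /cvgC ul us; apply/ler_addgt0Pr => e e0.
have [N hN] := ul e e0.
have := hN _ (leq_maxl N m0); have := us _ (leq_maxr N m0).
set m := maxn _ _ => h1; rewrite cmod_distC => h2.
have := cmodD (l - u m) (u m - s); rewrite addrA subrK; lra.
Qed.

Lemma cvgC_unique (u : nat -> C) (l l' : C) :
  u @ \oo --> l -> u @ \oo --> l' -> l = l'.
Proof.
move=> /cvgC ul /cvgC ul'; apply/eqP; rewrite -subr_eq0 -cmod_eq0 eq_le cmod_ge0 andbT.
apply/ler_addgt0Pr => e e0; rewrite add0r; have e2 : 0 < e / 2 by rewrite divr_gt0.
have [N hN] := ul _ e2; have [N' hN'] := ul' _ e2.
have := hN _ (leq_maxl N N'); have := hN' _ (leq_maxr N N').
set m := maxn _ _; rewrite cmod_distC => h1; rewrite cmod_distC => h2.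
have := cmodB (l - u m) (l' - u m).
have -> : l - u m - (l' - u m) = l - l' by ring.
move: h1 h2; lra.
Qed.

(** Completeness is applied to the real and imaginary parts. *)
Lemma cvg_series_dominated (u : nat -> C) (v : nat -> R) :
  (forall k, cmod (u k) <= v k) -> cvgn (series v) ->
  exists l : C, series u @ \oo --> l.
Proof.
move=> uv cv.
have RIle (z : C) : `|complex.Re z| <= cmod z /\ `|complex.Im z| <= cmod z.
  case: z => a b /=; rewrite -!sqrtr_sqr /cmod /=.
  by split; rewrite ler_sqrt ?lerDl ?lerDr ?addr_ge0 ?sqr_ge0.
have cRI (f : C -> R) : (forall z, `|f z| <= cmod z) ->
    cvgn (series (fun k => f (u k))).
  move=> fle; apply: normed_cvg; apply: (series_le_cvg _ _ _ cv) => k //=.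
    by rewrite (le_trans (cmod_ge0 (u k)))// uv.
  by rewrite (le_trans (fle _))// uv.
have cR := cRI _ (fun z => (RIle z).1); have cI := cRI _ (fun z => (RIle z).2).
pose a : R := limn (series (fun k => complex.Re (u k))).
pose b : R := limn (series (fun k => complex.Im (u k))).
exists (a +i* b)%C.
apply/cvgC => e e0; have e2 : 0 < e / 2 by rewrite divr_gt0.
move/cvgrPdist_lt : cR => /(_ _ e2)[N1 _ h1].
move/cvgrPdist_lt : cI => /(_ _ e2)[N2 _ h2].
exists (maxn N1 N2) => m; rewrite geq_max => /andP[m1 m2].
have := h1 m m1; have := h2 m m2; rewrite /=.
rewrite -/a -/b => hb ha.
have -> : series u m = (series (fun k => complex.Re (u k)) m +i*
                        series (fun k => complex.Im (u k)) m)%C.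
  rewrite /series /=; elim: m {m1 m2 ha hb} => [|m IH].
    by rewrite !big_geq.
  rewrite !big_nat_recr//= IH; by case: (u m) => p q.
set s := series _ m in ha *; set t := series _ m in hb *.
have -> : ((s +i* t : C) - (a +i* b))%C = ((s - a) +i* (t - b) : C)%C by [].
apply: (@le_lt_trans _ _ (`|s - a| + `|t - b|)); last first.
  by rewrite !(distrC _ a) !(distrC _ b); lra.
rewrite cmod_le_sqr ?addr_ge0// [leRHS]sqrrD !real_normK ?num_real//.
have : 0 <= `|s - a| * `|t - b| by rewrite mulr_ge0.
rewrite mulr2n; nra.
Qed.

End Limits.

(** * Second-order Taylor expansions *)

Section Jets.
Variable R : realType.
Local Notation C := (Cx R).
Implicit Types (f g r : C -> C) (t h z : C).

(** Boundedness near 0 with unspecified constants, so that remainders can be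
added and multiplied without tracking radii. *)
Definition bounded_germ r : Prop :=
  exists K d : R, 0 < d /\ forall h, cmod h <= d -> cmod (r h) <= K.

Lemma bounded_germ_cst z : bounded_germ (fun=> z).
Proof. by exists (cmod z), 1; split. Qed.

Lemma bounded_germ_id : bounded_germ id.
Proof. by exists 1, 1; split. Qed.

Lemma bounded_germD r r' :
  bounded_germ r -> bounded_germ r' -> bounded_germ (fun h => r h + r' h).
Proof.
move=> [K [d [d0 rK]]] [K' [d' [d'0 rK']]].
exists (K + K'), (Num.min d d'); split=> [|h]; first by rewrite lt_min d0.
rewrite le_min => /andP[hd hd'].
by rewrite (le_trans (cmodD _ _))// lerD ?rK ?rK'.
Qed.

Lemma bounded_germM r r' :
  bounded_germ r -> bounded_germ r' -> bounded_germ (fun h => r h * r' h).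
Proof.
move=> [K [d [d0 rK]]] [K' [d' [d'0 rK']]].
exists (K * K'), (Num.min d d'); split=> [|h]; first by rewrite lt_min d0.
rewrite le_min => /andP[hd hd'].
by rewrite cmodM ler_pM ?rK ?rK'.
Qed.

(** Second-order complex Taylor expansion with cubic remainder. It holds at each
point where [f] is given by a power series, and it is enough for the maximum
principle. Unlike power series it passes to products and quotients by mere
algebra: the identity is imposed for every [h], since only the boundedness of
[r] near 0 carries information. *)
Definition jet2 f t : Prop :=
  exists a b r, bounded_germ r /\
    forall h, f (t + h) = f t + a * h + b * h ^+ 2 + h ^+ 3 * r h.

Lemma jet2_of_bound f t (c a b : C) (K d : R) : 0 < d ->
  (forall h, cmod h <= d ->
     cmod (f (t + h) - (c + a * h + b * h ^+ 2)) <= K * cmod h ^+ 3) ->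
  jet2 f t.
Proof.
move=> d0 fK.
have ft : f t = c.
  have := fK 0; rewrite cmod0 ltW// !expr0n/= !(addr0, mulr0).
  by move=> /(_ isT) h0; apply/eqP; rewrite -subr_eq0 -cmod_eq0 eq_le h0 cmod_ge0.
exists a, b, (fun h => (f (t + h) - (c + a * h + b * h ^+ 2)) / h ^+ 3).
split; last first.
  move=> h; rewrite ft; have [->|h0] := eqVneq h 0.
    by rewrite addr0 ft !expr0n/= !mulr0 mul0r !addr0.
  by field.
exists `|K|, d; split=> // h hd; have [->|h0] := eqVneq h 0.
  by rewrite !expr0n/= invr0 mulr0 cmod0.
rewrite cmodf cmodX ler_pdivrMr ?exprn_gt0 ?cmod_gt0//.
by rewrite (le_trans (fK _ hd))// ler_wpM2r ?exprn_ge0// ler_norm.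
Qed.

Lemma jet2_eq f g t : (forall x, f x = g x) -> jet2 f t -> jet2 g t.
Proof. by move=> /funext->. Qed.

Lemma jet2_cst z t : jet2 (fun=> z) t.
Proof.
exists 0, 0, (fun=> 0); split; first exact: bounded_germ_cst.
by move=> h; rewrite !(mul0r, mulr0, addr0).
Qed.

Lemma jet2_id t : jet2 id t.
Proof.
exists 1, 0, (fun=> 0); split; first exact: bounded_germ_cst.
by move=> h; rewrite mul1r !(mul0r, mulr0, addr0).
Qed.

Lemma jet2D f g t : jet2 f t -> jet2 g t -> jet2 (fun x => f x + g x) t.
Proof.
move=> [a [b [r [rb fE]]]] [a' [b' [r' [rb' gE]]]].
exists (a + a'), (b + b'), (fun h => r h + r' h); split.
  exact: bounded_germD.
by move=> h; rewrite fE gE; ring.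
Qed.

Lemma jet2M f g t : jet2 f t -> jet2 g t -> jet2 (fun x => f x * g x) t.
Proof.
move=> [a [b [r [rb fE]]]] [a' [b' [r' [rb' gE]]]].
exists (f t * a' + a * g t), (f t * b' + a * a' + b * g t),
  (fun h => (a * b' + b * a') + b * b' * h +
     ((f t + a * h + b * (h * h)) * r' h + (g t + a' * h + b' * (h * h)) * r h)
     + h * (h * h) * (r h * r' h)); split; last by move=> h; rewrite fE gE; ring.
by do !(apply: bounded_germD || apply: bounded_germM ||
        apply: bounded_germ_id || apply: bounded_germ_cst || assumption).
Qed.

Lemma jet2X f t n : jet2 f t -> jet2 (fun x => f x ^+ n) t.
Proof.
move=> fj; elim: n => [|n IH].
  by apply: (jet2_eq _ (jet2_cst 1 t)) => x; rewrite expr0.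
by apply: (jet2_eq _ (jet2M fj IH)) => x; rewrite exprS.
Qed.

Lemma jet2_sum (I : Type) (s : seq I) (P : pred I) (F : I -> C -> C) t :
  (forall i, P i -> jet2 (F i) t) -> jet2 (fun x => \sum_(i <- s | P i) F i x) t.
Proof.
move=> Fj; elim: s => [|i s IH].
  by apply: (jet2_eq _ (jet2_cst 0 t)) => x; rewrite big_nil.
case: (boolP (P i)) => Pi.
  by apply: (jet2_eq _ (jet2D (Fj _ Pi) IH)) => x; rewrite big_cons Pi.
by apply: (jet2_eq _ IH) => x; rewrite big_cons (negbTE Pi).
Qed.

Lemma jet2_scale f (c : C) t : jet2 f (c * t) -> jet2 (fun x => f (c * x)) t.
Proof.
move=> [a [b [r [[K [d [d0 rK]]] fE]]]].
exists (a * c), (b * c ^+ 2), (fun h => c ^+ 3 * r (c * h)); split; last first.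
  by move=> h; rewrite mulrDr fE; ring.
apply: bounded_germM; first exact: bounded_germ_cst.
have c1 : 0 < cmod c + 1 by rewrite ltr_wpDl.
exists K, (d / (cmod c + 1)); split=> [|h hd]; first by rewrite divr_gt0.
apply: rK; rewrite cmodM; move: hd; rewrite ler_pdivlMr// => hd.
by apply: le_trans hd; rewrite mulrC ler_wpM2l// lerDl.
Qed.

Lemma jet2V t : t != 0 -> jet2 (fun x => x^-1) t.
Proof.
move=> t0; have ct0 : 0 < cmod t by rewrite cmod_gt0.
apply: (@jet2_of_bound _ t t^-1 (- t ^- 2) (t ^- 3) (2 / cmod t ^+ 4) (cmod t / 2)).
  by rewrite divr_gt0.
move=> h hd.
have th : cmod t / 2 <= cmod (t + h).
  have : cmod t <= cmod (t + h) + cmod h.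
    by rewrite -{1}[t](addrK h); exact: cmodB.
  by move: hd; lra.
have th0 : t + h != 0 by rewrite -cmod_gt0 (lt_le_trans _ th)// divr_gt0.
have -> : (t + h)^-1 - (t^-1 + - t ^- 2 * h + t ^- 3 * h ^+ 2) =
   - (h ^+ 3 / (t ^+ 3 * (t + h))) by field; rewrite t0 th0.
rewrite cmodN cmodf cmodM !cmodX mulrC ler_wpM2r ?exprn_ge0//.
have cth0 : 0 < cmod (t + h) by rewrite cmod_gt0.
rewrite -div1r ler_pdivrMr ?mulr_gt0 ?exprn_gt0// mulrAC.
rewrite ler_pdivlMr ?exprn_gt0// mul1r exprSr mulrCA ler_wpM2l ?exprn_ge0//.
by move: th; lra.
Qed.

Lemma jet2_near f g t (d : R) : 0 < d ->
  (forall h, cmod h <= d -> f (t + h) = g (t + h)) -> jet2 f t -> jet2 g t.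
Proof.
move=> d0 fg [a [b [r [[K [d' [d'0 rK]]] fE]]]].
apply: (@jet2_of_bound _ _ (f t) a b K (Num.min d d')).
  by rewrite lt_min d0.
move=> h; rewrite le_min => /andP[hd hd']; rewrite -fg// fE.
rewrite [X in cmod X](_ : _ = h ^+ 3 * r h); last by ring.
by rewrite cmodM cmodX mulrC ler_wpM2r ?exprn_ge0// rK.
Qed.

Lemma jet2_continuous f t : jet2 f t -> forall e : R, 0 < e ->
  exists2 d : R, 0 < d & forall h, cmod h <= d -> cmod (f (t + h) - f t) < e.
Proof.
move=> [a [b [r [rb fE]]]] e e0.
have [K [d [d0 gK]]] : bounded_germ (fun h => a + b * h + h * h * r h).
  by do !(apply: bounded_germD || apply: bounded_germM ||
        apply: bounded_germ_id || apply: bounded_germ_cst || assumption).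
have K0 : 0 <= K by rewrite (le_trans _ (gK 0 _))// cmod0 ltW.
have K1 : 0 < K + 1 by rewrite ltr_wpDl.
exists (Num.min d (e / (K + 1) / 2)).
  by rewrite lt_min d0 /= !divr_gt0.
move=> h; rewrite le_min => /andP[hd he].
have -> : f (t + h) - f t = h * (a + b * h + h * h * r h) by rewrite fE; ring.
rewrite cmodM; apply: (@le_lt_trans _ _ (cmod h * (K + 1))).
  by rewrite ler_wpM2l// (le_trans (gK _ hd))// lerDl.
rewrite -ltr_pdivlMr// (le_lt_trans he)//.
have : 0 < e / (K + 1) by rewrite divr_gt0.
by lra.
Qed.

End Jets.

(** * The maximum principle on a disc *)

Section MaximumPrinciple.
Variable R : realType.
Local Notation C := (Cx R).
Implicit Types (f : C -> C) (t h z : C).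

Lemma disc_max (g : C -> R) (s : R) : 0 <= s ->
  (forall t, cmod t <= s -> forall e : R, 0 < e -> exists2 d : R, 0 < d &
     forall h, cmod h <= d -> `|g (t + h) - g t| < e) ->
  exists2 t0, cmod t0 <= s & forall t, cmod t <= s -> g t <= g t0.
Proof.
move=> s0 gc.
pose A := [set p : R * R | p.1 ^+ 2 + p.2 ^+ 2 <= s ^+ 2].
have clA : closed A.
  have cf : continuous (fun p : R * R => p.1 ^+ 2 + p.2 ^+ 2 : R).
    move=> p; apply: cvgD.
      apply: (@continuous_comp _ _ _ fst (fun x : R => x ^+ 2) p).
        exact: cvg_fst.
      exact: exprn_continuous.
    apply: (@continuous_comp _ _ _ snd (fun x : R => x ^+ 2) p).
      exact: cvg_snd.
    exact: exprn_continuous.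
  exact: (closed_comp (fun p _ => cf p) (@closed_le R (s ^+ 2))).
have cA : compact A.
  apply: (@subclosed_compact _ _ (`[- s, s]%classic `*` `[- s, s]%classic)) => //.
    by apply: compact_setX; exact: segment_compact.
  move=> [a b] /= ab; rewrite !in_itv/= -!ler_norml.
  rewrite -(ger0_norm s0); split; rewrite -ler_sqr ?nnegrE// !real_normK ?num_real//;
  apply: le_trans ab; rewrite ?lerDl ?lerDr sqr_ge0//.
have A0 : A !=set0 by exists (0, 0) => /=; rewrite /A/= expr0n addr0 sqr_ge0.
have [|[a b]] := compact_EVT_max (f := fun p : R * R => g (p.1 +i* p.2)%C) A0 cA.
  apply: continuous_in_subspaceT => -[a b]; rewrite inE /A /= => ab.
  apply/cvgrPdist_lt => e e0.
  have /gc/(_ e e0)[d d0 gd] : cmod (a +i* b : C)%C <= s by rewrite cmod_le_sqr.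
  near=> p.
  have -> : (p.1 +i* p.2 : C)%C = (a +i* b : C)%C + ((p.1 - a) +i* (p.2 - b) : C)%C.
    by congr (_ +i* _)%C; ring.
  rewrite distrC; apply: gd.
  have pa : `|p.1 - a| < d / 2.
    near: p. apply: (@cvgr_distC_lt _ _ _ _ _ fst); last by rewrite divr_gt0.
    exact: cvg_fst.
  have pb : `|p.2 - b| < d / 2.
    near: p. apply: (@cvgr_distC_lt _ _ _ _ _ snd); last by rewrite divr_gt0.
    exact: cvg_snd.
  rewrite cmod_le_sqr ?ltW//.
  have sq x : `|x| < d / 2 -> x ^+ 2 <= (d / 2) ^+ 2.
    move=> xd; rewrite -real_normK ?num_real// ler_pXn2r// ?nnegrE ?ltW//.
    by rewrite divr_gt0.
  move: (sq _ pa) (sq _ pb); nra.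
rewrite inE /A /= => ab mx; exists (a +i* b)%C; first by rewrite cmod_le_sqr.
by move=> [a' b']; rewrite cmod_le_sqr// => ab'; apply: (mx (a', b')); rewrite inE.
Unshelve. all: by end_near.
Qed.

(** Strict subharmonicity of [|t| ^ 2] in discrete form: this is the perturbation
that excludes interior maxima in [max_principle]. *)
Lemma parallelogram t (r : R) : let i := ('i%C : C) in
  cmod (t + ofreal r) ^+ 2 + cmod (t - ofreal r) ^+ 2 +
  cmod (t + i * ofreal r) ^+ 2 + cmod (t - i * ofreal r) ^+ 2 =
  4 * cmod t ^+ 2 + 4 * r ^+ 2.
Proof.
case: t => a b i.
have -> : i * ofreal r = (0 +i* r : C)%C.
  by rewrite /i /ofreal; apply/eqP; rewrite eq_complex /=; simpc.
rewrite /ofreal /real_complex_def.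
rewrite -[(a +i* b)%C + _]/(_ +i* _ : C)%C -[(a +i* b)%C - _]/(_ +i* _ : C)%C.
rewrite -[(a +i* b)%C + (0 +i* r)%C]/(_ +i* _ : C)%C -[(a +i* b)%C - (0 +i* r)%C]/(_ +i* _ : C)%C.
rewrite !sqr_cmod; ring.
Qed.

(** If the bound failed inside, [|f| + e |t| ^ 2] would have an interior maximum
[t0] for small [e]. Over the four points [t0 + q], [t0 - q], [t0 + iq] and
[t0 - iq] the terms of orders 1 and 2 of [f] cancel, so the mean of [|f|] is
at least [|f t0|] up to a multiple of [q ^ 3], while the mean of [e |t| ^ 2]
exceeds its value at [t0] by [e q ^ 2]: a contradiction for small [q]. *)
Lemma max_principle f (s B : R) : 0 < s ->
  (forall t, cmod t <= s -> jet2 f t) ->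
  (forall t, cmod t = s -> cmod (f t) <= B) ->
  forall t, cmod t <= s -> cmod (f t) <= B.
Proof.
move=> s0 fj fB t1 t1s; rewrite leNgt; apply/negP => Bt1.
(* Small enough that [psi t1] still exceeds [psi] on the boundary circle, where
   [psi] is at most [B + e s ^ 2]. *)
pose e := (cmod (f t1) - B) / 2 / s ^+ 2.
have e0 : 0 < e by rewrite !divr_gt0 ?exprn_gt0// subr_gt0.
have es : e * s ^+ 2 = (cmod (f t1) - B) / 2 by rewrite divfK// gt_eqF// exprn_gt0.
pose psi t := cmod (f t) + e * cmod t ^+ 2.
have psij t : cmod t <= s -> forall e : R, 0 < e -> exists2 d : R, 0 < d &
    forall h, cmod h <= d -> `|psi (t + h) - psi t| < e.
  move=> /fj tj e' e'0.
  have e2 : 0 < e' / 2 by rewrite divr_gt0.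
  have [d d0 fd] := jet2_continuous tj e2.
  pose k := e * (2 * cmod t + 1) + 1.
  have k0 : 0 < k by rewrite ltr_wpDl// mulr_ge0 ?(ltW e0)// addr_ge0// mulr_ge0.
  exists (Num.min (Num.min d 1) (e' / 2 / k)).
    by rewrite !lt_min d0 ltr01 divr_gt0.
  move=> h; rewrite !le_min => /andP[/andP[hd h1] hk].
  have := fd _ hd; have := cmod_dist (f (t + h)) (f t).
  have : `|cmod (t + h) ^+ 2 - cmod t ^+ 2| <= cmod h * (2 * cmod t + 1).
    rewrite subr_sqr normrM ler_pM ?normr_ge0//.
      by rewrite (le_trans (cmod_dist _ _))// addrC addKr.
    rewrite ger0_norm ?addr_ge0//; have := cmodD t h; lra.
  move: hk; rewrite ler_pdivlMr// /k => hk; rewrite /psi.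
  set u := cmod (t + h) ^+ 2 - _; set v := cmod (f (t + h)) - _.
  move=> hu hv fd'.
  have -> : cmod (f (t + h)) + e * cmod (t + h) ^+ 2 -
    (cmod (f t) + e * cmod t ^+ 2) = v + e * u by rewrite /u /v; ring.
  apply: le_lt_trans (ler_normD _ _) _.
  rewrite normrM (gtr0_norm e0).
  have : e * `|u| <= e * (cmod h * (2 * cmod t + 1)) by rewrite ler_wpM2l// ltW.
  have := cmod_ge0 h; lra.
have [t0 t0s t0m] := disc_max (ltW s0) psij.
have Bpsi : B + e * s ^+ 2 < psi t0.
  apply: lt_le_trans (t0m _ t1s); rewrite es /psi.
  have : 0 <= e * cmod t1 ^+ 2 by rewrite mulr_ge0 ?exprn_ge0// ltW.
  by move: Bt1; lra.
have {t0s}t0s : cmod t0 < s.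
  rewrite lt_neqAle t0s andbT; apply/eqP => t0s'.
  by move: Bpsi; rewrite /psi t0s' ltrD2r ltNge fB.
have [a [b [r [[K [d [d0 rK]]] fE]]]] := fj _ (ltW t0s).
have K0 : 0 <= K by rewrite (le_trans _ (rK 0 _))// cmod0 ltW.
(* Within the reach of the remainder bound, within the disc, and with
   [K q < e] for the final contradiction. *)
pose q := Num.min (Num.min d (s - cmod t0)) (e / (K + 1)).
have K1 : 0 < K + 1 by rewrite ltr_wpDl.
have q0 : 0 < q by rewrite !lt_min d0 subr_gt0 t0s /= divr_gt0.
have [[qd qs] qe] : (q <= d /\ q <= s - cmod t0) /\ q * (K + 1) <= e.
  by rewrite -ler_pdivlMr// /q !ge_min !lexx ?orbT.
pose i : C := 'i%C; pose h : C := ofreal q.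
have i1 : cmod i = 1 by rewrite /cmod /= expr0n expr1n add0r sqrtr1.
have i2 : i ^+ 2 = -1 by exact: sqr_i.
have i3 : i ^+ 3 = - i by rewrite exprSr i2 mulN1r.
have ch : cmod h = q by rewrite cmod_ofreal gtr0_norm.
have hin z : cmod z = q -> psi (t0 + z) <= psi t0.
  by move=> zq; apply: t0m; have := cmodD t0 z; lra.
have hk z : cmod z = q -> cmod (h ^+ 3 * r z) <= q ^+ 3 * K.
  move=> zq; rewrite cmodM cmodX ch ler_wpM2l ?exprn_ge0 ?(ltW q0)//.
  by apply: rK; rewrite zq.
have := hin h ch; have := hin (- h); have := hin (i * h); have := hin (- (i * h)).
rewrite !cmodN cmodM i1 ch mul1r => /(_ erefl) H1 /(_ erefl) H2 /(_ erefl) H3 H4.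
have S : 4 * cmod (f t0) <= cmod (f (t0 + h)) + cmod (f (t0 - h)) +
    cmod (f (t0 + i * h)) + cmod (f (t0 - i * h)) + 4 * (q ^+ 3 * K).
  have E : 4%:R * f t0 = f (t0 + h) + f (t0 - h) + f (t0 + i * h) + f (t0 - i * h)
     - (h ^+ 3 * r h - h ^+ 3 * r (- h) - i * (h ^+ 3 * r (i * h)) + i * (h ^+ 3 * r (- (i * h)))).
    have -> : i * (h ^+ 3 * r (i * h)) = - ((i * h) ^+ 3 * r (i * h)).
      by rewrite exprMn i3; ring.
    have -> : i * (h ^+ 3 * r (- (i * h))) = - ((i * h) ^+ 3 * r (- (i * h))).
      by rewrite exprMn i3; ring.
    rewrite !fE !sqrrN exprMn i2; ring.
  have -> : 4 * cmod (f t0) = cmod (4%:R * f t0) by rewrite cmodM cmod_nat.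
  rewrite E.
  apply: le_trans (cmodB _ _) _; apply: lerD.
    by do 3 (apply: le_trans (cmodD _ _) _; rewrite ?lerD2r).
  apply: le_trans (cmodD _ _) _.
  have := cmodB (h ^+ 3 * r h - h ^+ 3 * r (- h)) (i * (h ^+ 3 * r (i * h))).
  have := cmodB (h ^+ 3 * r h) (h ^+ 3 * r (- h)).
  rewrite !(cmodM i) i1 !mul1r.
  have := hk _ ch; have := hk (- h); have := hk (i * h); have := hk (- (i * h)).
  rewrite !cmodN cmodM i1 ch mul1r => /(_ erefl) ? /(_ erefl) ? /(_ erefl) ?; lra.
have := parallelogram t0 q; rewrite -/i -/h /= => P.
move: H1 H2 H3 H4; rewrite /psi => H1 H2 H3 H4.
have : 4 * (e * q ^+ 2) <= 4 * (q ^+ 3 * K).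
  have : e * (cmod (t0 + h) ^+ 2 + cmod (t0 - h) ^+ 2 + cmod (t0 + i * h) ^+ 2 +
    cmod (t0 - i * h) ^+ 2) = e * (4 * cmod t0 ^+ 2 + 4 * q ^+ 2) by rewrite P.
  lra.
have -> : q ^+ 3 * K = q * K * q ^+ 2 by ring.
rewrite ler_pM2l// ler_pM2r ?exprn_gt0// => eqK.
by move: qe; rewrite mulrDr mulr1; lra.
Qed.

End MaximumPrinciple.

(** * Schwarz lemma, Cauchy inequality and Taylor series in one variable *)

Section OneVariable.
Variable R : realType.
Local Notation C := (Cx R).
Implicit Types (f g : C -> C) (t h z : C) (c : nat -> C).

(** An asymptotic expansion at 0 to all orders. Convergence of the series is not
part of it, which makes it stable under the averages and truncations below. *)
Definition expands f c : Prop := forall m, exists K d : R, 0 < d /\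
  forall h, cmod h <= d ->
    cmod (f h - \sum_(0 <= k < m) c k * h ^+ k) <= K * cmod h ^+ m.

Lemma expands_eq f g c e : (forall x, f x = g x) -> (forall k, c k = e k) ->
  expands f c -> expands g e.
Proof. by move=> /funext-> /funext->. Qed.

Lemma expandsB f g c e : expands f c -> expands g e ->
  expands (fun x => f x - g x) (fun k => c k - e k).
Proof.
move=> fc ge m.
have [K [d [d0 fK]]] := fc m; have [K' [d' [d'0 gK]]] := ge m.
exists (K + K'), (Num.min d d'); split; first by rewrite lt_min d0.
move=> h; rewrite le_min => /andP[hd hd'].
rewrite [X in cmod X](_ : _ = (f h - \sum_(0 <= k < m) c k * h ^+ k) -
   (g h - \sum_(0 <= k < m) e k * h ^+ k)).
  by rewrite mulrDl (le_trans (cmodB _ _))// lerD ?fK ?gK.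
under eq_bigr do rewrite mulrBl; rewrite sumrB; ring.
Qed.

Lemma expands_monomial (e : C) j :
  expands (fun x => e * x ^+ j) (fun k => if k == j then e else 0).
Proof.
move=> m; exists (cmod e), 1; split=> // h h1.
have [mj|jm] := leqP m j.
  rewrite big_nat big1 ?subr0.
    by rewrite cmodM cmodX ler_wpM2l// ler_wiXn2l.
  by move=> k /andP[_ km]; rewrite ltn_eqF ?mul0r// (leq_trans km).
rewrite (bigD1_seq j) ?mem_index_iota ?iota_uniq//= eqxx big1.
  by rewrite addr0 subrr cmod0 mulr_ge0// exprn_ge0.
by move=> k /negbTE->; rewrite mul0r.
Qed.

Lemma expands_tail f c m : expands f c ->
  expands (fun x => f x - \sum_(0 <= k < m) c k * x ^+ k)
          (fun k => if (k < m)%N then 0 else c k).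
Proof.
move=> fc; elim: m => [|m IH].
  by apply: expands_eq fc => // x; rewrite big_geq// subr0.
apply: expands_eq (expandsB IH (expands_monomial (c m) m)) => [x|k].
  by rewrite big_nat_recr//=; ring.
by rewrite ltnS; case: ltngtP => [|?|->]; rewrite ?subr0 ?subrr.
Qed.

Lemma expands_rotations f c N (a w : nat -> C) : (forall l, cmod (w l) = 1) ->
  expands f c ->
  expands (fun x => \sum_(0 <= l < N) a l * f (w l * x))
          (fun k => c k * \sum_(0 <= l < N) a l * w l ^+ k).
Proof.
move=> w1 fc m; have [K [d [d0 fK]]] := fc m.
exists (\sum_(0 <= l < N) cmod (a l) * K), d; split=> // h hd.
rewrite [X in cmod X](_ : _ = \sum_(0 <= l < N) a l *
    (f (w l * h) - \sum_(0 <= k < m) c k * (w l * h) ^+ k)).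
  rewrite (le_trans (cmod_sum _ _ _))// mulr_suml ler_sum// => l _.
  have wh : cmod (w l * h) = cmod h by rewrite cmodM w1 mul1r.
  by rewrite cmodM -mulrA ler_wpM2l// -wh fK// wh.
under [RHS]eq_bigr do rewrite mulrBr; rewrite sumrB; congr (_ - _).
under [RHS]eq_bigr do rewrite mulr_sumr; rewrite exchange_big/=.
apply: eq_bigr => k _; rewrite mulr_sumr mulr_suml; apply: eq_bigr => l _.
by rewrite exprMn; ring.
Qed.

(** The maximum principle for the quotient [f t / t ^ m], extended by [c m] at 0.
The quotient has a second-order expansion at 0 because [f] has one of order
[m + 2], and elsewhere because [t ^ m] does not vanish. *)
Lemma schwarz f c m (s B : R) : 0 < s ->
  (forall t, cmod t <= s -> jet2 f t) -> expands f c ->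
  (forall k, (k < m)%N -> c k = 0) ->
  (forall t, cmod t = s -> cmod (f t) <= B) ->
  cmod (c m) * s ^+ m <= B /\
  forall t, cmod t <= s -> cmod (f t) * s ^+ m <= B * cmod t ^+ m.
Proof.
move=> s0 fj fc c0 fB.
pose g t := if t == 0 then c m else f t / t ^+ m.
have sm : 0 < s ^+ m by rewrite exprn_gt0.
have gB t : cmod t <= s -> cmod (g t) <= B / s ^+ m.
  apply: max_principle => // {}t.
    move=> ts; have [->|t0] := eqVneq t 0.
      have [K [d [d0 fK]]] := fc m.+3.
      apply: (@jet2_of_bound _ _ _ (c m) (c m.+1) (c m.+2) K d) => // h hd.
      rewrite add0r /g; have [->|h0] := eqVneq h 0.
        by rewrite cmod0 !expr0n/= !mulr0 !addr0 subrr cmod0.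
      have := fK _ hd.
      rewrite !big_nat_recr//= big_nat big1 ?add0r; last first.
        by move=> k /andP[_ km]; rewrite c0// mul0r.
      have hm : 0 < cmod h ^+ m by rewrite exprn_gt0// cmod_gt0.
      move=> {}fK; rewrite -(ler_pM2r hm) -[leRHS]mulrA -exprD add3n.
      rewrite -cmodX -cmodM (le_trans _ fK)// le_eqVlt; apply/orP; left.
      by apply/eqP; congr cmod; rewrite mulrBl divfK ?expf_neq0// !exprS; ring.
    have t2 : 0 < cmod t / 2 by rewrite divr_gt0// cmod_gt0.
    apply: (@jet2_near _ (fun x => f x * x^-1 ^+ m) _ _ _ t2); last first.
      by apply: jet2M; [exact: fj|apply: jet2X; exact: jet2V].
    move=> h ht; rewrite /g; case: eqVneq => th; last by rewrite exprVn.
    have hE : h = - t by apply/eqP; rewrite -addr_eq0 addrC th.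
    by exfalso; move: ht; rewrite hE cmodN; clear -t2; lra.
  move=> ts; rewrite /g; case: eqVneq => [t0|_].
    by move: s0; rewrite -ts t0 cmod0 ltxx.
  by rewrite cmodf cmodX ts ler_pM2r ?invr_gt0// fB.
split; first by have := gB 0; rewrite cmod0 (ltW s0) /g eqxx ler_pdivlMr// => ->.
move=> t ts; have := gB _ ts; rewrite /g; case: eqVneq => [->|t0].
  rewrite ler_pdivlMr// => cB; rewrite cmod0.
  have f0 : f 0 = if m is 0 then c 0 else 0.
    have [K [d [d0 /(_ 0)]]] := fc 1%N.
    rewrite cmod0 expr1 mulr0 (ltW d0) big_nat1 expr0 mulr1 => /(_ isT) h0.
    have /eqP -> : f 0 == c 0 by rewrite -subr_eq0 -cmod_eq0 eq_le h0 cmod_ge0.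
    by move: c0; case: (m) => [//|m' c0]; rewrite c0.
  rewrite f0; case: (m) cB => [|m']; first by rewrite !expr0 !mulr1.
  by rewrite cmod0 mul0r expr0n mulr0.
rewrite cmodf cmodX ler_pdivlMr// mulrAC ler_pdivrMr// exprn_gt0//.
by rewrite cmod_gt0.
Qed.

Lemma prim_rootC N : (0 < N)%N -> exists w : C, N.-primitive_root w.
Proof.
move=> N0; pose p : {poly R[i]%C} := 'X^N - 1.
have [r Dp] := closed_field_poly_normal p.
rewrite (monicP _) ?monicXnsubC // scale1r in Dp.
have rn1 : all N.-unity_root r by apply/allP=> z; rewrite -root_prod_XsubC -Dp.
have sz_r : (N < (size r).+1)%N by rewrite -(size_prod_XsubC r id) -Dp size_XnsubC.
have [|z zr prz] := hasP (cyclic.has_prim_root N0 rn1 _ sz_r); last by exists z.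
by rewrite -separable.separable_prod_XsubC -Dp cyclotomic.separable_Xn_sub_1 // pnatr_eq0 -lt0n.
Qed.

Lemma cmod_prim_root N (w : C) : N.-primitive_root w -> cmod w = 1.
Proof.
move=> pw; have := cmodX w N; rewrite prim_expr_order// cmod1 => /esym/eqP.
by rewrite pexpr_eq1 ?(prim_order_gt0 pw)// => /eqP.
Qed.

(** The range [i, k < N] turns equality modulo [N] into equality. *)
Lemma sum_prim_root N (w : C) i k : N.-primitive_root w ->
  (i < N)%N -> (k < N)%N ->
  \sum_(0 <= l < N) (w ^+ i / w ^+ k) ^+ l = if i == k then N%:R else 0.
Proof.
move=> pw iN kN.
have w0 : w != 0 by rewrite -cmod_eq0 (cmod_prim_root pw) oner_eq0.
case: eqVneq => [->|ik].
  rewrite divff ?expf_neq0// (eq_bigr (fun=> 1)).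
    by rewrite big_const_nat subn0 iter_addr_0.
  by move=> *; rewrite expr1n.
set q := _ / _; have q1 : q != 1.
  apply: contra ik => /eqP qE.
  have : w ^+ i == w ^+ k by rewrite -[w ^+ i](divfK (expf_neq0 k w0)) -/q qE mul1r.
  by rewrite (eq_prim_root_expr pw) !modn_small.
have qN : q ^+ N = 1.
  by rewrite /q exprMn exprVn -!exprM ![(_ * N)%N]mulnC !exprM (prim_expr_order pw)// !expr1n divr1.
apply/eqP; have /eqP := subrX1 q N.
by rewrite qN subrr eq_sym mulf_eq0 subr_eq0 (negbTE q1) /= big_mkord.
Qed.

(** The mean of [w ^ (- l k) f (w ^ l t)] over the [k + 1]-st roots of unity
[w ^ l] removes the coefficients of index below [k], keeps [c k], and does not
increase the bound on the circle; then the Schwarz lemma applies. *)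
Lemma cauchy_bound f c (s B : R) k : 0 < s ->
  (forall t, cmod t <= s -> jet2 f t) -> expands f c ->
  (forall t, cmod t = s -> cmod (f t) <= B) ->
  cmod (c k) * s ^+ k <= B.
Proof.
move=> s0 fj fc fB; have [w pw] := prim_rootC (ltn0Sn k).
have w1 := cmod_prim_root pw.
have wl l : cmod (w ^+ l) = 1 by rewrite cmodX w1 expr1n.
pose a l : C := k.+1%:R^-1 / (w ^+ l) ^+ k.
have Sa i : (i <= k)%N ->
    \sum_(0 <= l < k.+1) a l * w ^+ l ^+ i = if i == k then 1 else 0.
  move=> ik; rewrite (eq_bigr (fun l => k.+1%:R^-1 * (w ^+ i / w ^+ k) ^+ l)).
    rewrite -mulr_sumr (sum_prim_root pw)//; case: ifP => _; rewrite ?mulr0//.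
    by rewrite mulVf// pnatr_eq0.
  move=> l _; rewrite /a -mulrA; congr (_ * _); rewrite mulrC expr_div_n.
  by rewrite -!exprM ![(l * _)%N]mulnC.
pose e i := c i * \sum_(0 <= l < k.+1) a l * w ^+ l ^+ i.
have eE i : (i <= k)%N -> e i = if i == k then c i else 0.
  by move=> ik; rewrite /e (Sa i ik); case: ifP => _; rewrite ?mulr1 ?mulr0.
have fg : expands (fun x => \sum_(0 <= l < k.+1) a l * f (w ^+ l * x)) e.
  exact: expands_rotations.
have [] := @schwarz _ _ k s B s0 _ fg.
- move=> t ts; apply: jet2_sum => l _; apply: jet2M; first exact: jet2_cst.
  by apply: jet2_scale; apply: fj; rewrite cmodM wl mul1r.
- by move=> i ik; rewrite (eE i (ltnW ik)) (ltn_eqF ik).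
- move=> t ts; apply: le_trans (cmod_sum _ _ _) _.
  rewrite (@le_trans _ _ (\sum_(0 <= l < k.+1) k.+1%:R^-1 * B))//.
    apply: ler_sum => l _; rewrite cmodM cmodf cmodX wl expr1n divr1 cmodV cmod_nat.
    by rewrite ler_wpM2l ?invr_ge0// fB// cmodM wl mul1r.
  rewrite big_const_nat subn0 iter_addr_0 -[X in X <= _]mulr_natl mulrA.
  by rewrite mulfV ?mul1r// pnatr_eq0.
by rewrite (eE k (leqnn k)) eqxx.
Qed.

(** With [s = u ^ 2] and [u > 1], Bernoulli gives a linear lower bound for each of
the two factors [u ^ m], and their product is quadratic in [m]. *)
Lemma linear_le_expr (s M e : R) : 1 < s -> 0 <= M -> 0 < e ->
  exists N, forall m, (N <= m)%N -> m.+1%:R * M < e * s ^+ m.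
Proof.
move=> s1 M0 e0; pose u := Num.sqrt s.
have u1 : 1 < u by rewrite -sqrtr1 ltr_sqrt// (lt_trans _ s1).
pose k := Num.min 1 (u - 1); have k0 : 0 < k by rewrite lt_min ltr01 subr_gt0.
have ku : 0 < u - k by rewrite subr_gt0 (le_lt_trans _ u1)// ge_min lexx.
have us m : s ^+ m = u ^+ m * u ^+ m.
  by rewrite -exprMn -expr2 sqr_sqrtr// ltW// (lt_trans _ s1).
have kum m : k * m.+1%:R <= u ^+ m.
  elim: m => [|m IH]; first by rewrite expr0 mulr1 ge_min lexx.
  have : 1 <= u ^+ m by rewrite exprn_ege1// ltW.
  have : k <= u - 1 by rewrite ge_min lexx orbT.
  rewrite exprS -[m.+2]addn1 natrD; move: IH u1; nra.
pose N := Num.bound (M / (e * k ^+ 2)).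
have Nb : M / (e * k ^+ 2) < N%:R.
  by rewrite archi_boundP// divr_ge0// mulr_ge0 ?exprn_ge0 ?ltW.
exists N => m Nm; rewrite us.
apply: (@lt_le_trans _ _ (e * (k * m.+1%:R * (k * m.+1%:R)))); last first.
  by rewrite ler_wpM2l ?(ltW e0)// ler_pM// mulr_ge0// ltW.
have -> : e * (k * m.+1%:R * (k * m.+1%:R)) = m.+1%:R * (e * k ^+ 2 * m.+1%:R).
  by ring.
rewrite ltr_pM2l// mulrC -ltr_pdivrMr ?mulr_gt0 ?exprn_gt0//.
by rewrite (lt_le_trans Nb)// ler_nat (leq_trans Nm).
Qed.

(** On the circle of radius [s] the Taylor remainder of order [m] is at most
[(m + 1) M], where [M] bounds [f], since each term is at most [M] by Cauchy's
inequality. It vanishes to order [m] at 0, so by the Schwarz lemma it is at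
most [(m + 1) M / s ^ m] at 1. *)
Lemma taylor_at1 f c (s : R) : 1 < s ->
  (forall t, cmod t <= s -> jet2 f t) -> expands f c ->
  forall e : R, 0 < e -> exists N, forall m, (N <= m)%N ->
    cmod (\sum_(0 <= k < m) c k - f 1) < e.
Proof.
move=> s1 fj fc e e0; have s0 : 0 < s by rewrite (lt_trans _ s1).
have [t0 t0s fM] : exists2 t0, cmod t0 <= s &
    forall t, cmod t <= s -> cmod (f t) <= cmod (f t0).
  apply: (disc_max (ltW s0)) => t /fj tj e' e'0.
  have [d d0 fd] := jet2_continuous tj e'0.
  by exists d => // h hd; rewrite (le_lt_trans (cmod_dist _ _))// fd.
set M := cmod (f t0) in fM.
have cM k : cmod (c k) * s ^+ k <= M.
  by apply: (cauchy_bound k s0 fj fc) => t ts; rewrite fM// ts.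
have [N hN] := linear_le_expr s1 (cmod_ge0 (f t0)) e0.
exists N => m Nm.
have [] := @schwarz _ _ m s (m.+1%:R * M) s0 _ (expands_tail m fc).
- move=> t ts; apply: jet2D; first exact: fj.
  apply: (@jet2_eq _ (fun x => -1 * \sum_(0 <= k < m) c k * x ^+ k)).
    by move=> x; rewrite mulN1r.
  apply: jet2M; first exact: jet2_cst.
  apply: jet2_sum => k _; apply: jet2M; first exact: jet2_cst.
  by apply: jet2X; exact: jet2_id.
- by move=> k ->.
- move=> t ts; apply: le_trans (cmodB _ _) _.
  rewrite -[m.+1]add1n natrD mulrDl mul1r lerD ?fM ?ts//.
  apply: le_trans (cmod_sum _ _ _) _.
  apply: (@le_trans _ _ (\sum_(0 <= k < m) M)).
    by apply: ler_sum => k _; rewrite cmodM cmodX ts.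
  by rewrite big_const_nat subn0 iter_addr_0 mulr_natl.
move=> _ /(_ 1); rewrite cmod1 expr1n mulr1 (ltW s1) => /(_ isT).
under eq_bigr do rewrite expr1n mulr1.
move=> /le_lt_trans/(_ (hN _ Nm)).
by rewrite ltr_pM2r ?exprn_gt0// cmod_distC.
Qed.

End OneVariable.

(** * Multi-indices and homogeneous polynomials *)

Section MultiIndices.
Variable n : nat.
Implicit Types (J K : 'I_n -> nat).

Lemma leq_mdeg J j : (J j <= mdeg J)%N.
Proof. by rewrite /mdeg (bigD1 j)//= leq_addr. Qed.

Lemma midx_le k (J : {ffun 'I_n -> 'I_k.+1}) j : (midx J j <= k)%N.
Proof. by rewrite /midx -ltnS. Qed.

Lemma midx_inj k : injective (@midx n k).
Proof.
move=> J J' JJ'; apply/ffunP => j; apply/val_inj.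
exact: (congr1 (fun f => f j) JJ').
Qed.

Definition ffun_midx k J : {ffun 'I_n -> 'I_k.+1} := [ffun j => inord (J j)].

Lemma ffun_midxK k J : (forall j, J j <= k)%N -> midx (ffun_midx k J) = J.
Proof. by move=> Jk; apply/funext => j; rewrite /midx ffunE inordK// ltnS. Qed.

Lemma midx_exists k J : (mdeg J <= k)%N ->
  exists J' : {ffun 'I_n -> 'I_k.+1}, midx J' = J.
Proof.
move=> Jk; exists (ffun_midx k J); rewrite ffun_midxK// => j.
exact: leq_trans (leq_mdeg J j) Jk.
Qed.

Section Monomials.
Variable T : comNzRingType.
Implicit Types (w x : 'I_n -> T).

Lemma mpowM w x K : mpow (fun j => w j * x j) K = mpow w K * mpow x K.
Proof. by rewrite /mpow -big_split; apply: eq_bigr => j _; rewrite exprMn. Qed.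

Lemma mpow_cst (c : T) K : mpow (fun=> c) K = c ^+ mdeg K.
Proof. by rewrite /mpow /mdeg expr_sum. Qed.

Lemma hpolyZ (a : ('I_n -> nat) -> T) k (t : T) w :
  hpoly a k (fun j => t * w j) = t ^+ k * hpoly a k w.
Proof.
rewrite /hpoly mulr_sumr; apply: eq_bigr => J /eqP Jk.
by rewrite mpowM mpow_cst Jk mulrCA.
Qed.

Lemma hpoly0 (a : ('I_n -> nat) -> T) w :
  hpoly a 0 w = a (fun=> 0%N).
Proof.
have J0 (J : {ffun 'I_n -> 'I_1}) : midx J = fun=> 0%N.
  by apply/funext => j; rewrite /midx ord1.
rewrite /hpoly (big_pred1 (ffun_midx 0 (fun=> 0%N))) => [|J].
  by rewrite J0 /mpow big1 ?mulr1// => j _.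
have -> : J = ffun_midx 0 (fun=> 0%N) by apply: midx_inj; rewrite !J0.
by rewrite J0 /mdeg big1 //= !eqxx.
Qed.

End Monomials.

Section RealMonomials.
Variable R : realType.
Implicit Types (x y : 'I_n -> R).

Lemma mpow_ge0 x K : (forall j, 0 <= x j) -> 0 <= mpow x K.
Proof. by move=> x0; apply: prodr_ge0 => j _; rewrite exprn_ge0. Qed.

Lemma mpow_gt0 x K : (forall j, 0 < x j) -> 0 < mpow x K.
Proof. by move=> x0; apply: prodr_gt0 => j _; rewrite exprn_gt0. Qed.

Lemma le_mpow x y K : (forall j, 0 <= x j <= y j) -> mpow x K <= mpow y K.
Proof.
move=> xy; apply: ler_prod => j _; have /andP[x0 xyj] := xy j.
by rewrite exprn_ge0//= lerXn2r// nnegrE (le_trans x0).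
Qed.

Lemma mpowV x K : mpow (fun j => (x j)^-1) K = (mpow x K)^-1.
Proof. by rewrite /mpow -prodfV; apply: eq_bigr => j _; rewrite exprVn. Qed.

Lemma cmod_mpow (w : 'I_n -> Cx R) K :
  cmod (mpow w K) = mpow (fun j => cmod (w j)) K.
Proof. by rewrite /mpow cmod_prod; apply: eq_bigr => j _; rewrite cmodX. Qed.

Lemma cmod_hpoly (a : ('I_n -> nat) -> Cx R) k (w : 'I_n -> Cx R) :
  cmod (hpoly a k w) <= hpoly (fun J => cmod (a J)) k (fun j => cmod (w j)).
Proof.
apply: le_trans (cmod_sum _ _ _) _; apply: ler_sum => J _.
by rewrite cmodM cmod_mpow.
Qed.

Lemma hpoly_ge0 (a : ('I_n -> nat) -> R) k x :
  (forall J, 0 <= a J) -> (forall j, 0 <= x j) -> 0 <= hpoly a k x.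
Proof. by move=> a0 x0; apply: sumr_ge0 => J _; rewrite mulr_ge0 ?mpow_ge0. Qed.

(** The crude count [(k + 1) ^ n <= 2 ^ (n k)] of monomials is geometric in [k],
which a smaller radius absorbs. *)
Lemma hpoly_le_card (a : ('I_n -> nat) -> R) k x (B : R) : 0 <= B ->
  (forall J, mdeg J = k -> a J * mpow x J <= B) ->
  hpoly a k x <= (2 ^+ n) ^+ k * B.
Proof.
move=> B0 aB; apply: (@le_trans _ _ (\sum_(J : {ffun 'I_n -> 'I_k.+1}) B)).
  rewrite /hpoly big_mkcond /=; apply: ler_sum => J _.
  by case: eqP => // Jk; exact: aB.
rewrite sumr_const card_ffun !card_ord -[leLHS]mulr_natl ler_wpM2r//.
rewrite -exprM mulnC exprM natrX lerXn2r ?nnegrE ?exprn_ge0// -natrX ler_nat.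
exact: ltn_expl.
Qed.

(** The mean of [P w] times the inverse character [w ^ (- J)] over the points of
the torus whose arguments are [k + 1]-st roots of unity is the term of index
[J], because exponents at most [k] are determined modulo [k + 1]. *)
Lemma poly_coef_bound (a : ('I_n -> nat) -> Cx R) k (rho : 'I_n -> R) (B : R) :
  (forall j, 0 <= rho j) ->
  (forall w : 'I_n -> Cx R, (forall j, cmod (w j) = rho j) ->
     cmod (hpoly a k w) <= B) ->
  forall J, mdeg J = k -> cmod (a J) * mpow rho J <= B.
Proof.
move=> rho0 aB J Jk; have [w pw] := prim_rootC R (ltn0Sn k).
have w1 := cmod_prim_root pw.
pose v (l : {ffun 'I_n -> 'I_k.+1}) (j : 'I_n) : Cx R := ofreal (rho j) * w ^+ l j.
have cv l j : cmod (v l j) = rho j.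
  by rewrite cmodM cmodX w1 expr1n mulr1 cmod_ofreal ger0_norm.
pose W (l : {ffun 'I_n -> 'I_k.+1}) : Cx R := \prod_j (w ^+ l j ^+ J j)^-1.
have cW l : cmod (W l) = 1.
  rewrite cmod_prod big1// => j _.
  by rewrite cmodV !cmodX w1 !expr1n invr1.
pose M : Cx R := (k.+1 ^ n)%:R.
have Jle j : (J j <= k)%N by rewrite -Jk leq_mdeg.
have E : \sum_l W l * hpoly a k (v l) = M * (a J * mpow (fun j => ofreal (rho j)) J).
  pose S (K : {ffun 'I_n -> 'I_k.+1}) :=
    \prod_j \sum_(l < k.+1) (w ^+ K j / w ^+ J j) ^+ l.
  have SE (K : {ffun 'I_n -> 'I_k.+1}) : S K = if K == ffun_midx k J then M else 0.
    case: eqP => [->|KJ].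
      rewrite /S (eq_bigr (fun=> k.+1%:R)) => [|j _].
        by rewrite prodr_const card_ord /M natrX.
      rewrite -(big_mkord xpredT (fun l => (_ / _) ^+ l)) /=.
      rewrite (sum_prim_root pw); [by rewrite ffunE inordK ?eqxx ?ltnS|exact: ltn_ord|by rewrite ltnS].
    have [j Kj] : exists j, K j != ffun_midx k J j.
      by apply/existsP; apply: contra_notT KJ => /existsPn KJ;
        apply/ffunP => j; apply/eqP; rewrite -[_ == _]negbK KJ.
    rewrite /S (bigD1 j)//= -(big_mkord xpredT (fun l => (_ / _) ^+ l)) /=.
    rewrite (sum_prim_root pw)//; last by rewrite ltnS.
    rewrite ifN ?mul0r//; apply: contra Kj => /eqP Kj; apply/eqP/val_inj.
    by rewrite /= Kj /ffun_midx ffunE inordK// ltnS.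
  transitivity (\sum_(K : {ffun 'I_n -> 'I_k.+1} | mdeg (midx K) == k)
      a (midx K) * mpow (fun j => ofreal (rho j)) (midx K) * S K).
    under eq_bigr do rewrite /hpoly mulr_sumr.
    rewrite exchange_big /=; apply: eq_bigr => K _.
    rewrite /S bigA_distr_bigA /= mulr_sumr; apply: eq_bigr => l _.
    rewrite /v mpowM mulrCA -!mulrA; congr (_ * _).
    rewrite mulrCA; congr (_ * _).
    rewrite /W /mpow -big_split /=; apply: eq_bigr => j _.
    rewrite mulrC expr_div_n -!exprM /midx; congr (w ^+ _ / w ^+ _); exact: mulnC.
  rewrite (bigD1 (ffun_midx k J)) ?ffun_midxK ?Jk//= SE eqxx big1 ?addr0.
    by rewrite mulrC.
  by move=> K /andP[_ /negbTE KJ]; rewrite SE KJ mulr0.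
have M0 : 0 < cmod M by rewrite cmod_nat ltr0n expn_gt0.
have : cmod M * (cmod (a J) * mpow rho J) <= cmod M * B.
  have -> : cmod M * (cmod (a J) * mpow rho J) =
      cmod (M * (a J * mpow (fun j => ofreal (rho j)) J)).
    rewrite !cmodM cmod_mpow; congr (_ * (_ * mpow _ _)).
    by apply/funext => j; rewrite cmod_ofreal ger0_norm.
  rewrite -E; apply: le_trans (cmod_sum _ _ _) _.
  apply: (@le_trans _ _ (\sum_(l : {ffun 'I_n -> 'I_k.+1}) B)).
    by apply: ler_sum => l _; rewrite cmodM cW mul1r aB.
  by rewrite sumr_const card_ffun !card_ord -[leLHS]mulr_natl cmod_nat.
by rewrite ler_pM2l.
Qed.

End RealMonomials.
End MultiIndices.

(** * Termwise differentiation: algebraic estimates *)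

Section TermwiseDerivative.
Variable n : nat.
Implicit Types (j : 'I_n).

(** The coefficients of the formal partial derivative along [j]. *)
Definition dcoef (T : comNzRingType) j (a : ('I_n -> nat) -> T) (J : 'I_n -> nat) : T :=
  (J j).+1%:R * a (fun i => (J i + (i == j))%N).

Definition shift_coord (T : comNzRingType) (w : 'I_n -> T) j (h : T) : 'I_n -> T :=
  fun i => w i + (if i == j then h else 0).

Lemma mpow_shift (T : comNzRingType) (w : 'I_n -> T) j h (J : 'I_n -> nat) :
  mpow (shift_coord w j h) J = (w j + h) ^+ J j * \prod_(i | i != j) w i ^+ J i.
Proof.
rewrite /mpow (bigD1 j)//= /shift_coord eqxx; congr (_ * _).
by apply: eq_bigr => i /negbTE->; rewrite addr0.
Qed.

(** Differentiation matches the indices of degree [k] with those of degree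
[k + 1] whose entry [j] is positive; the remaining ones contribute 0. *)
Lemma hpoly_dcoef (T : comNzRingType) (a : ('I_n -> nat) -> T) j k
    (w : 'I_n -> T) :
  hpoly (dcoef j a) k w =
  \sum_(J : {ffun 'I_n -> 'I_k.+2} | mdeg (midx J) == k.+1)
    a (midx J) * ((midx J j)%:R * w j ^+ (midx J j).-1 *
                  \prod_(i | i != j) w i ^+ midx J i).
Proof.
pose up (J : {ffun 'I_n -> 'I_k.+1}) : {ffun 'I_n -> 'I_k.+2} :=
  ffun_midx k.+1 (fun i => midx J i + (i == j))%N.
pose dn (J : {ffun 'I_n -> 'I_k.+2}) : {ffun 'I_n -> 'I_k.+1} :=
  ffun_midx k (fun i => midx J i - (i == j))%N.
have upE J : midx (up J) = (fun i => midx J i + (i == j))%N.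
  by apply: ffun_midxK => i; rewrite -addn1 leq_add// ?midx_le// leq_b1.
have degup J : mdeg (midx (up J)) = (mdeg (midx J)).+1.
  rewrite upE /mdeg big_split /= -addn1; congr (_ + _)%N.
  by rewrite (bigD1 j)//= eqxx big1 // => i /negbTE->.
rewrite [RHS](bigID (fun J => 0 < midx J j)%N) /= addrC big1 ?add0r; last first.
  by move=> J /andP[_]; rewrite lt0n negbK => /eqP->; rewrite !mul0r mulr0.
rewrite [RHS](reindex_onto up dn) /=; last first.
  move=> J /andP[/eqP Jk J0]; apply: midx_inj; rewrite upE.
  have dnE : midx (dn J) = (fun i => midx J i - (i == j))%N.
    apply: ffun_midxK => i; case: eqVneq => [->|ij].
      by rewrite leq_subLR add1n midx_le.
    have := leqnn k.+1; rewrite -{1}Jk /mdeg (bigD1 j)//= (bigD1 i)//= subn0 => Jk1.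
    by rewrite -ltnS; apply: leq_trans Jk1; rewrite -add1n leq_add// leq_addr.
  apply/funext => i; rewrite dnE; case: eqVneq => [->|_]; first by rewrite subnK.
  by rewrite subn0 addn0.
rewrite /hpoly; apply: eq_big => [J|J _].
  rewrite degup eqSS upE eqxx addn1 /= andbT.
  suff -> : dn (up J) = J by rewrite eqxx andbT.
  apply: midx_inj; rewrite ffun_midxK ?upE => [|i]; last by rewrite addnK midx_le.
  by apply/funext => i; rewrite addnK.
rewrite upE /dcoef eqxx addn1 /= /mpow [in LHS](bigD1 j)//=.
rewrite (eq_bigr (fun i => w i ^+ (midx J i + (i == j)))); first by ring.
by move=> i /negbTE->; rewrite addn0.
Qed.

(** As a polynomial in [u] and [h] the second-order remainder of [(u + h) ^ m] has
nonnegative coefficients and is divisible by [h ^ 2]. Keeping the full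
remainder on the right-hand side is what lets the induction go through. *)
Lemma expr_second_difference (R : realType) (u h : Cx R) (d : R) m :
  0 < d -> cmod h <= d ->
  cmod ((u + h) ^+ m - u ^+ m - h * (m%:R * u ^+ m.-1)) <=
  (cmod h / d) ^+ 2 *
    ((cmod u + d) ^+ m - cmod u ^+ m - d * (m%:R * cmod u ^+ m.-1)).
Proof.
move=> d0 hd; elim: m => [|m IH].
  by rewrite !expr0 !mul0r !mulr0 !subrr cmod0 mulr0.
pose e := (cmod u + d) ^+ m - cmod u ^+ m - d * (m%:R * cmod u ^+ m.-1).
have -> : (u + h) ^+ m.+1 - u ^+ m.+1 - h * (m.+1%:R * u ^+ m.+1.-1) =
    (u + h) * ((u + h) ^+ m - u ^+ m - h * (m%:R * u ^+ m.-1)) +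
    m%:R * (h ^+ 2 * u ^+ m.-1).
  by case: m {IH e} => [|m]; rewrite /= !exprS ?expr0; ring.
have -> : (cmod u + d) ^+ m.+1 - cmod u ^+ m.+1 -
     d * (m.+1%:R * cmod u ^+ m.+1.-1) =
    (cmod u + d) * e + m%:R * (d ^+ 2 * cmod u ^+ m.-1).
  by rewrite /e; case: m {IH e} => [|m]; rewrite /= !exprS ?expr0; ring.
rewrite [leRHS]mulrDr; apply: le_trans (cmodD _ _) _; apply: lerD.
  rewrite cmodM [leRHS]mulrCA ler_pM//.
  by rewrite (le_trans (cmodD _ _))// lerD2l.
rewrite !cmodM cmod_nat !cmodX le_eqVlt; apply/orP; left; apply/eqP.
by field; rewrite gt_eqF.
Qed.

Lemma expr_second_difference_le (R : realType) (u h : Cx R) (d : R) m :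
  0 < d -> cmod h <= d ->
  cmod ((u + h) ^+ m - u ^+ m - h * (m%:R * u ^+ m.-1)) <=
  (cmod h / d) ^+ 2 * (cmod u + d) ^+ m.
Proof.
move=> d0 hd; apply: le_trans (expr_second_difference u m d0 hd) _.
rewrite ler_wpM2l ?sqr_ge0// -addrA -opprD lerBlDr lerDl.
by rewrite addr_ge0 ?mulr_ge0 ?exprn_ge0 ?ler0n ?(ltW d0).
Qed.

Lemma deriv_le_expr (R : realType) (x d : R) m : 0 <= x -> 0 < d ->
  d * (m%:R * x ^+ m.-1) <= (x + d) ^+ m.
Proof.
move=> x0 d0; have := @expr_second_difference R (ofreal x) (ofreal d) d m d0.
rewrite !cmod_ofreal gtr0_norm// ger0_norm// lexx => /(_ isT).
rewrite divff ?gt_eqF// expr1n mul1r => /(le_trans (cmod_ge0 _)).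
have : 0 <= x ^+ m by rewrite exprn_ge0.
lra.
Qed.

Section Estimates.
Variable R : realType.
Implicit Types (a : ('I_n -> nat) -> Cx R) (w : 'I_n -> Cx R).
Let absc a : ('I_n -> nat) -> R := fun J => cmod (a J).
Let absv w : 'I_n -> R := fun i => cmod (w i).

(** The bound does not depend on [h] apart from the factor [h ^ 2], so it can be
summed over [k] before [h] tends to 0. *)
Lemma hpoly_second_difference a j k w (h : Cx R) (d : R) :
  0 < d -> cmod h <= d ->
  cmod (hpoly a k.+1 (shift_coord w j h) - hpoly a k.+1 w -
        h * hpoly (dcoef j a) k w) <=
  (cmod h / d) ^+ 2 * hpoly (absc a) k.+1 (shift_coord (absv w) j d).
Proof.
move=> d0 hd.
have -> : hpoly a k.+1 (shift_coord w j h) - hpoly a k.+1 w -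
        h * hpoly (dcoef j a) k w =
  \sum_(J : {ffun 'I_n -> 'I_k.+2} | mdeg (midx J) == k.+1)
    a (midx J) * (((w j + h) ^+ midx J j - w j ^+ midx J j -
      h * ((midx J j)%:R * w j ^+ (midx J j).-1)) *
                  \prod_(i | i != j) w i ^+ midx J i).
  rewrite hpoly_dcoef mulr_sumr /hpoly -!sumrB; apply: eq_bigr => J _.
  have -> : mpow w (midx J) =
      w j ^+ midx J j * \prod_(i | i != j) w i ^+ midx J i.
    by rewrite /mpow (bigD1 j).
  rewrite mpow_shift; ring.
rewrite /hpoly mulr_sumr; apply: le_trans (cmod_sum _ _ _) _.
apply: ler_sum => J _; rewrite mpow_shift cmodM [leRHS]mulrCA ler_wpM2l//.
rewrite cmodM [leRHS]mulrA cmod_prod ler_pM//.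
- exact: prodr_ge0.
- exact: expr_second_difference_le.
by apply: ler_prod => i _; rewrite cmod_ge0 cmodX lexx.
Qed.

Lemma hpoly_dcoef_le a j k (x : 'I_n -> R) (d : R) :
  (forall i, 0 <= x i) -> 0 < d ->
  d * hpoly (absc (dcoef j a)) k x <= hpoly (absc a) k.+1 (shift_coord x j d).
Proof.
move=> x0 d0.
have -> : absc (dcoef j a) = dcoef j (absc a).
  by apply/funext => J; rewrite /absc /dcoef cmodM cmod_nat.
rewrite hpoly_dcoef mulr_sumr; apply: ler_sum => J _.
rewrite mpow_shift [leLHS]mulrCA; apply: ler_wpM2l; first exact: cmod_ge0.
rewrite [leLHS]mulrA; apply: ler_wpM2r; last exact: deriv_le_expr.
by apply: prodr_ge0 => i _; rewrite exprn_ge0.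
Qed.

End Estimates.
End TermwiseDerivative.

(** * Power series in several variables and their partial derivatives *)

Section PowerSeries.
Variables (R : realType) (n : nat).
Local Notation C := (Cx R).
Implicit Types (z : 'rV[C]_n) (a : ('I_n -> nat) -> C) (F : 'rV[C]_n -> C).

(** The local condition in the definition of analyticity, with the coefficients
and the radius made explicit. *)
Definition power_series_on F a z0 (rho : R) : Prop :=
  forall z, (forall j, cmod (z 0 j - z0 0 j) < rho) ->
      cvgn (series (fun k => hpoly (fun J => cmod (a J)) k
                               (fun j => cmod ((z - z0) 0 j)))) /\
      series (fun k => hpoly a k ((z - z0) 0)) @ \oo --> F z.

Lemma power_series_center F a z0 (rho : R) : 0 < rho ->
  power_series_on F a z0 rho -> F z0 = a (fun=> 0%N).
Proof.
move=> rho0 /(_ z0); case=> [j|_]; first by rewrite subrr cmod0.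
move=> Fz0; apply: cvgC_unique Fz0 _.
apply/cvgC => e e0; exists 1%N => -[//|m] _.
rewrite /series /= big_nat_recl//= hpoly0 big1 ?addr0 ?subrr ?cmod0// => k _.
rewrite (_ : hpoly a k.+1 _ = hpoly a k.+1 (fun j => 0 * (z0 - z0) 0 j)).
  by rewrite hpolyZ expr0n mul0r.
by congr (hpoly _ _ _); apply/funext => j; rewrite subrr mxE mul0r.
Qed.

(** At a point of the open polydisc, coordinate [j] can be enlarged by a positive
[d] while staying inside. The absolutely convergent series at the enlarged
moduli dominates both the differentiated series and the second-order remainders
of its terms, so differentiation is termwise and the radius is unchanged. *)
Lemma power_series_partial F a z0 (rho : R) j :
  power_series_on F a z0 rho ->
  power_series_on (partial j F) (dcoef j a) z0 rho.
Proof.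
move=> Fa z zrho.
pose w : 'I_n -> C := (z - z0) 0; pose x i := cmod (w i).
have xrho i : x i < rho by rewrite /x /w !mxE.
pose d := (rho - x j) / 2.
have d0 : 0 < d by rewrite divr_gt0// subr_gt0.
have xd0 i : 0 <= shift_coord x j d i.
  by apply: addr_ge0; [exact: cmod_ge0|case: ifP => // _; exact: ltW].
pose A k := hpoly (fun J => cmod (a J)) k (shift_coord x j d).
have cA : cvgn (series A).
  have [|cA _] := Fa (z0 + \row_i ofreal (shift_coord x j d i)).
    move=> i; rewrite !mxE addrAC subrr add0r cmod_ofreal ger0_norm //.
    rewrite /shift_coord; case: eqVneq => [->|_]; last by rewrite addr0.
    by rewrite /d; have := xrho j; lra.
  have E k : hpoly (fun J => cmod (a J)) k
    (fun i => cmod ((z0 + \row_i ofreal (shift_coord x j d i) - z0) 0 i)) = A k.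
    congr (hpoly _ _ _); apply/funext => i.
    by rewrite !mxE addrAC subrr add0r cmod_ofreal ger0_norm.
  by move: cA; rewrite (funext E).
have A0 k : 0 <= A k by apply: hpoly_ge0.
have leA k : hpoly (fun J => cmod (dcoef j a J)) k x <= d^-1 * A k.+1.
  by rewrite ler_pdivlMl//; apply: hpoly_dcoef_le => // i; exact: cmod_ge0.
have serA m : series A m <= limn (series A).
  apply: nondecreasing_cvgn_le => //; apply/nondecreasing_seqP => k.
  by rewrite /series /= big_nat_recr//= lerDl.
have serA1 m : \sum_(0 <= k < m) A k.+1 <= limn (series A).
  by apply: le_trans (serA m.+1); rewrite /series /= big_nat_recl//= lerDr.
have cD : cvgn (series (fun k => hpoly (fun J => cmod (dcoef j a J)) k x)).
  apply: nondecreasing_is_cvgn.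
    apply/nondecreasing_seqP => k.
    by rewrite /series /= big_nat_recr//= lerDl; apply: hpoly_ge0 => [J|i]; exact: cmod_ge0.
  exists (d^-1 * limn (series A)) => _ [m _ <-].
  rewrite /series /=; apply: le_trans (ler_sum _ (fun k _ => leA k)) _.
  by rewrite -mulr_sumr ler_wpM2l// invr_ge0 ltW.
split=> //.
have [l Dl] := cvg_series_dominated (fun k => cmod_hpoly (dcoef j a) k w) cD.
suff -> : partial j F z = l by [].
have rem (h : C) : cmod h <= d ->
    cmod (F (h *: delta_mx 0 j + z) - F z - h * l) <=
    (cmod h / d) ^+ 2 * limn (series A).
  move=> hd.
  have wE : (h *: delta_mx 0 j + z - z0) 0 = shift_coord w j h.
    apply/funext => i; rewrite !mxE /shift_coord /w !mxE eqxx /= eq_sym.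
    by case: eqVneq => _; rewrite ?mulr1 ?mulr0; ring.
  have [|_ Fh] := Fa (h *: delta_mx 0 j + z).
    move=> i; have -> : (h *: delta_mx 0 j + z) 0 i - z0 0 i = shift_coord w j h i.
      by rewrite -wE !mxE.
    rewrite /shift_coord; case: eqVneq => [->|_]; last by rewrite addr0; exact: xrho.
    apply: le_lt_trans (cmodD _ _) _; have := xrho j; rewrite -/(x j).
    by move: hd; rewrite /d; lra.
  have [_ Fz] := Fa _ zrho; rewrite wE in Fh.
  apply: (lim_remainder_le Fh Fz Dl) => m.
  rewrite /series /= !big_nat_recl//= !hpoly0 opprD addrACA subrr add0r.
  rewrite mulr_sumr -!sumrB; apply: le_trans (cmod_sum _ _ _) _.
  apply: le_trans (ler_sum _ (fun k _ => hpoly_second_difference a j k w d0 hd)) _.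
  by rewrite -mulr_sumr ler_wpM2l ?sqr_ge0// serA1.
rewrite /partial /derive; apply: cvg_lim => //.
apply/cvgrPdist_lt => _ /gt0_ofreal[e e0 ->].
have S0 : 0 <= limn (series A) by apply: le_trans (serA 0%N); rewrite /series /= big_geq.
have S1 : 0 < limn (series A) + 1 by rewrite ltr_wpDl.
pose q := Num.min d (e * d ^+ 2 / (limn (series A) + 1)).
have q0 : 0 < q by rewrite lt_min d0 divr_gt0// mulr_gt0// exprn_gt0.
apply/nbhs_ballP; exists (ofreal q); first by rewrite /= -[0]/(ofreal 0) ltC_ofreal.
move=> h /=; rewrite /ball /= sub0r normrN normE ltC_ofreal => hq h0.
rewrite normE ltC_ofreal cmod_distC /GRing.scale /=.
have h0' : 0 < cmod h by rewrite cmod_gt0.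
have := rem h; rewrite (ltW (lt_le_trans hq _)) ?ge_min ?lexx// => /(_ isT) hs.
rewrite [X in cmod X](_ : _ = h^-1 * (F (h *: delta_mx 0 j + z) - F z - h * l)).
  rewrite cmodM cmodV mulrC ltr_pdivrMr//; apply: le_lt_trans hs _.
  rewrite expr_div_n expr2 -mulrA -[X in X < _]mulrA.
  rewrite [ltRHS]mulrC ltr_pM2l// mulrAC ltr_pdivrMr ?exprn_gt0//.
  have : cmod h < e * d ^+ 2 / (limn (series A) + 1).
    by rewrite (lt_le_trans hq)// ge_min lexx orbT.
  by rewrite ltr_pdivlMr// mulrDr mulr1; lra.
by rewrite [RHS]mulrBr mulKf.
Qed.

Lemma power_series_iter F a z0 (rho : R) j m :
  power_series_on F a z0 rho ->
  power_series_on (iter m (partial j) F) (iter m (dcoef j) a) z0 rho.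
Proof.
move=> Fa; elim: m => [|m IH]; first exact: Fa.
rewrite !iterS; exact: power_series_partial.
Qed.

Lemma power_series_mderiv F a z0 (rho : R) K :
  power_series_on F a z0 rho ->
  power_series_on (mderiv K F)
    (foldr (fun j b => iter (K j) (dcoef j) b) a (enum 'I_n)) z0 rho.
Proof.
move=> Fa; rewrite /mderiv; elim: (enum _) => [|j s IH]; first exact: Fa.
exact: power_series_iter.
Qed.

(** Stated with the factorials cross-multiplied, to avoid division. *)
Lemma iter_dcoef (a : ('I_n -> nat) -> C) j m J :
  iter m (dcoef j) a J * (J j)`!%:R =
  a (fun i => (J i + (i == j) * m)%N) * (J j + m)`!%:R.
Proof.
elim: m J => [|m IH] J.
  rewrite addn0 /=; congr (a _ * _); apply/funext => i.
  by rewrite muln0 addn0.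
rewrite iterS {1}/dcoef mulrAC -natrM -factS mulrC.
have := IH (fun i => (J i + (i == j))%N); rewrite eqxx addn1 => ->.
rewrite addSnnS; congr (a _ * _); apply/funext => i.
by rewrite mulnS addnA.
Qed.

Lemma foldr_dcoef (a : ('I_n -> nat) -> C) K (s : seq 'I_n) J : uniq s ->
  foldr (fun j b => iter (K j) (dcoef j) b) a s J * (\prod_(j <- s) (J j)`!)%:R =
  a (fun i => (J i + (i \in s) * K i)%N) * (\prod_(j <- s) (J j + K j)`!)%:R.
Proof.
elim: s J => [|j s IH] J /=.
  rewrite !big_nil (_ : (fun i => _) = J)//.
  by apply/funext => i; rewrite mul0n addn0.
move=> /andP[js us]; rewrite !big_cons !natrM mulrA iter_dcoef.
pose J' i := (J i + (i == j) * K j)%N; rewrite -/J'; have J'J i : i \in s -> J' i = J i.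
  move=> i_s; rewrite /J'; case: eqVneq => [ij|_]; last by rewrite addn0.
  by rewrite -ij i_s in js.
have -> : (\prod_(i <- s) (J i)`! = \prod_(i <- s) (J' i)`!)%N.
  by apply: eq_big_seq => i /J'J->.
rewrite mulrAC.
rewrite IH// mulrAC -mulrA; congr (a _ * _).
  apply/funext => i; rewrite /J' in_cons; case: eqVneq => [->|_].
    by rewrite (negbTE js) !mul1n addn0.
  by rewrite addn0.
have -> : (\prod_(i <- s) (J' i + K i)`! = \prod_(i <- s) (J i + K i)`!)%N.
  by apply: eq_big_seq => i /J'J->.
by [].
Qed.

(** The expansion of the iterated derivative [mderiv K F], evaluated at its centre,
reduces to the term of index 0, which is [K!] times the coefficient [a K]. *)
Lemma taylor_coef_power_series F a z0 (rho : R) : 0 < rho ->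
  power_series_on F a z0 rho -> taylor_coef F z0 = a.
Proof.
move=> rho0 Fa; apply/funext => K; rewrite /taylor_coef.
rewrite (power_series_center rho0 (power_series_mderiv K Fa)).
have := foldr_dcoef a K (fun=> 0%N) (enum_uniq 'I_n).
rewrite big1 ?mulr1// => ->.
rewrite (_ : (fun i => _) = K); last first.
  by apply/funext => i; rewrite mem_enum mul1n add0n.
rewrite big_enum /= mulfK// pnatr_eq0 -lt0n prodn_gt0// => j.
exact: fact_gt0.
Qed.

End PowerSeries.

(** * The Euclidean norm and slices of the ball *)

Section EuclideanNorm.
Variables (R : realType) (n : nat).
Implicit Types (x y : 'I_n -> R).

Lemma enormR_ge0 x : 0 <= enormR x.
Proof. exact: sqrtr_ge0. Qed.

Lemma sqr_enormR x : enormR x ^+ 2 = \sum_j x j ^+ 2.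
Proof. by rewrite sqr_sqrtr// sumr_ge0// => j _; rewrite sqr_ge0. Qed.

Lemma enormR_eq0 x : enormR x = 0 -> forall j, x j = 0.
Proof.
move=> x0 j; have /eqP := sqr_enormR x; rewrite x0 expr0n eq_sym psumr_eq0.
  by move=> /allP/(_ j (mem_index_enum j)) /=; rewrite sqrf_eq0 => /eqP.
by move=> i _; rewrite sqr_ge0.
Qed.

Lemma cauchy_schwarz x y : \sum_j x j * y j <= enormR x * enormR y.
Proof.
have [X0|X0] := eqVneq (enormR x) 0.
  by rewrite X0 mul0r big1// => j _; rewrite (enormR_eq0 X0) mul0r.
have [Y0|Y0] := eqVneq (enormR y) 0.
  by rewrite Y0 mulr0 big1// => j _; rewrite (enormR_eq0 Y0) mulr0.
have {}X0 : 0 < enormR x by rewrite lt0r X0 enormR_ge0.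
have {}Y0 : 0 < enormR y by rewrite lt0r Y0 enormR_ge0.
set X := enormR x in X0 *; set Y := enormR y in Y0 *.
have xy j : x j * y j <= 2^-1 * (Y / X * x j ^+ 2 + X / Y * y j ^+ 2).
  have : 0 <= (Y * x j - X * y j) ^+ 2 / (X * Y).
    by rewrite divr_ge0 ?sqr_ge0// mulr_ge0// ltW.
  have -> : (Y * x j - X * y j) ^+ 2 / (X * Y) =
      Y / X * x j ^+ 2 + X / Y * y j ^+ 2 - 2 * (x j * y j).
    by field; rewrite !gt_eqF.
  by lra.
apply: le_trans (ler_sum _ (fun j _ => xy j)) _.
rewrite -mulr_sumr big_split /= -!mulr_sumr -!sqr_enormR -/X -/Y.
rewrite le_eqVlt; apply/orP; left; apply/eqP.
by field; rewrite !gt_eqF.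
Qed.

Lemma enormR_triangle x y :
  enormR (fun j => x j + y j) <= enormR x + enormR y.
Proof.
rewrite -ler_sqr ?nnegrE ?addr_ge0 ?enormR_ge0// sqr_enormR sqrrD !sqr_enormR.
have -> : \sum_j (x j + y j) ^+ 2 =
    \sum_j x j ^+ 2 + (\sum_j x j * y j) *+ 2 + \sum_j y j ^+ 2.
  by rewrite -sumrMnl -!big_split; apply: eq_bigr => j _; rewrite sqrrD.
by rewrite lerD2r lerD2l lerMn2r cauchy_schwarz.
Qed.

Lemma le_enormR x y : (forall j, 0 <= x j <= y j) -> enormR x <= enormR y.
Proof.
move=> xy; rewrite ler_wsqrtr//; apply: ler_sum => j _.
by have /andP[x0 xyj] := xy j; rewrite lerXn2r// nnegrE// (le_trans x0).
Qed.

Lemma enormRZ (c : R) x : 0 <= c -> enormR (fun j => c * x j) = c * enormR x.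
Proof.
move=> c0; rewrite /enormR.
have -> : \sum_j (c * x j) ^+ 2 = c ^+ 2 * \sum_j x j ^+ 2.
  by rewrite mulr_sumr; apply: eq_bigr => j _; rewrite exprMn.
by rewrite sqrtrM ?sqr_ge0// sqrtr_sqr ger0_norm.
Qed.

Lemma enormC_lineD (z w : 'rV[Cx R]_n) (t : Cx R) :
  enormC (z + t *: w) <= enormC z + cmod t * enormC w.
Proof.
rewrite /enormC -enormRZ//; apply: le_trans (enormR_triangle _ _).
apply: le_enormR => j; rewrite cmod_ge0 /= !mxE.
by rewrite (le_trans (cmodD _ _))// cmodM.
Qed.

(** The strict coordinatewise bounds give the strict bound [|w| < 1 - |z|], which
leaves room for a dilation factor above 1. *)
Lemma ball_slack (z w : 'rV[Cx R]_n) : unit_ball z ->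
  (forall j, Num.sqrt n%:R * cmod (w 0 j) < 1 - enormC z) ->
  exists2 s : R, 1 < s & forall t, cmod t <= s -> unit_ball (z + t *: w).
Proof.
rewrite /unit_ball /= => zB wz; have k0 : 0 < 1 - enormC z by rewrite subr_gt0.
have wk : enormC w < 1 - enormC z.
  have [n0|n0] := posnP n.
    rewrite /enormC /enormR big1 ?sqrtr0// => j _.
    by have := ltn_ord j; rewrite {2}n0.
  have N0 : 0 < n%:R :> R by rewrite ltr0n.
  rewrite -ltr_sqr ?nnegrE ?enormR_ge0 ?(ltW k0)// sqr_enormR.
  apply: (@lt_le_trans _ _ (\sum_(j < n) (1 - enormC z) ^+ 2 / n%:R)).
    apply: ltr_sum => [|j _]; first by apply/hasP; exists (Ordinal n0); rewrite ?mem_index_enum.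
    rewrite ltr_pdivlMr// mulrC -[X in X * _]sqr_sqrtr ?ltW// -exprMn.
    by rewrite ltr_sqr// nnegrE ?mulr_ge0 ?sqrtr_ge0// ltW.
  by rewrite sumr_const card_ord -[leLHS]mulr_natr divfK// gt_eqF.
set k := 1 - enormC z in k0 wk *; set W := enormC w in wk *.
have W0 : 0 <= W by exact: enormR_ge0.
have Wk : 0 < W + k by rewrite ltr_wpDl.
exists (2 * k / (W + k)); first by rewrite ltr_pdivlMr// mul1r; lra.
move=> t ts; apply: le_lt_trans (enormC_lineD _ _ _) _; rewrite -/W.
have : cmod t * W < k; last by rewrite /k; lra.
apply: (@le_lt_trans _ _ (2 * k / (W + k) * W)); first by rewrite ler_wpM2r.
rewrite mulrAC ltr_pdivrMr// -mulrA mulrCA ltr_pM2l//; lra.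
Qed.

End EuclideanNorm.

(** * Taylor series and Cauchy inequality on polydiscs in the ball *)

Section AnalyticLines.
Variables (R : realType) (n : nat).
Local Notation C := (Cx R).
Implicit Types (z w : 'rV[C]_n) (a : ('I_n -> nat) -> C) (F : 'rV[C]_n -> C).

(** Along a slice the homogeneous parts of the series become the coefficients of
a one-variable expansion. *)
Lemma power_series_expands F a z0 (rho : R) w : 0 < rho ->
  power_series_on F a z0 rho ->
  expands (fun x => F (z0 + x *: w)) (fun k => hpoly a k (w 0)).
Proof.
move=> rho0 Fa m.
(* Scaling by [rho / W] brings [w] inside the polydisc of convergence. *)
pose W := 1 + \sum_j cmod (w 0 j).
have W0 : 0 < W by rewrite ltr_pwDl// sumr_ge0.
pose d := rho / W; have d0 : 0 < d by rewrite divr_gt0.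
have dw j : d * cmod (w 0 j) < rho.
  rewrite /d mulrAC ltr_pdivrMr// ltr_pM2l// /W (bigD1 j)//=.
  have : 0 <= \sum_(i | i != j) cmod (w 0 i) by rewrite sumr_ge0.
  lra.
have hrho (h : C) : cmod h <= d ->
    forall j, cmod ((z0 + h *: w) 0 j - z0 0 j) < rho.
  move=> hd j; rewrite !mxE addrAC subrr add0r cmodM.
  by apply: le_lt_trans (dw j); rewrite ler_wpM2r.
have wE (h : C) k : hpoly a k ((z0 + h *: w - z0) 0) = hpoly a k (w 0) * h ^+ k.
  rewrite mulrC -hpolyZ; congr (hpoly _ _ _); apply/funext => j.
  by rewrite !mxE addrAC subrr add0r.
have cd : cmod (ofreal d) = d by rewrite cmod_ofreal gtr0_norm.
pose A k := hpoly (fun J => cmod (a J)) k (fun j => cmod ((z0 + ofreal d *: w - z0) 0 j)).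
have [|cA _] := Fa (z0 + ofreal d *: w); first by apply: hrho; rewrite cd.
have A0 k : 0 <= A k by apply: hpoly_ge0.
have serA m' : series A m' <= limn (series A).
  apply: nondecreasing_cvgn_le => //; apply/nondecreasing_seqP => k.
  by rewrite /series /= big_nat_recr//= lerDl.
have aA k : cmod (hpoly a k (w 0)) * d ^+ k <= A k.
  by rewrite -cd -cmodX -cmodM -wE cmod_hpoly.
exists (limn (series A) / d ^+ m), d; split=> // h hd.
have [_ Fh] := Fa _ (hrho _ hd).
apply: (cmod_lim_dist_le (m0 := m) Fh) => m' mm'.
rewrite /series /=; under eq_bigr do rewrite wE.
rewrite (big_cat_nat (leq0n m) mm') /= addrAC subrr add0r.
apply: le_trans (cmod_sum _ _ _) _.
have hd1 : 0 <= cmod h / d by rewrite divr_ge0// ltW.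
apply: (@le_trans _ _ (\sum_(m <= k < m') (cmod h / d) ^+ m * A k)).
  rewrite big_nat [leRHS]big_nat; apply: ler_sum => k /andP[mk _].
  rewrite cmodM cmodX.
  have -> : cmod (hpoly a k (w 0)) * cmod h ^+ k =
      (cmod h / d) ^+ k * (cmod (hpoly a k (w 0)) * d ^+ k).
    by rewrite expr_div_n; field; rewrite expf_neq0// gt_eqF.
  apply: ler_pM => //.
  - by rewrite exprn_ge0.
  - by rewrite mulr_ge0// exprn_ge0// ltW.
  - by apply: ler_wiXn2l => //; rewrite ler_pdivrMr// mul1r.
rewrite -mulr_sumr expr_div_n.
have -> : limn (series A) / d ^+ m * cmod h ^+ m =
    cmod h ^+ m / d ^+ m * limn (series A) by ring.
rewrite ler_wpM2l//; first by rewrite divr_ge0 ?exprn_ge0 ?(ltW d0).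
apply: le_trans (serA m'); rewrite /series /= (big_cat_nat (leq0n m) mm') /=.
by rewrite lerDr sumr_ge0.
Qed.

Lemma expands_jet2 (f : C -> C) (c : nat -> C) t :
  expands (fun h => f (t + h)) c -> jet2 f t.
Proof.
move=> /(_ 3%N)[K [d [d0 fK]]].
apply: (@jet2_of_bound _ _ _ (c 0%N) (c 1%N) (c 2%N) K d) => // h hd.
have := fK h hd.
by rewrite !big_nat_recr //= big_geq // add0r expr0 mulr1 expr1.
Qed.

Section Analytic.
Variables (F : 'rV[C]_n -> C) (hF : analytic_on_ball F).

Lemma taylor_power_series z0 : unit_ball z0 ->
  exists2 rho : R, 0 < rho & power_series_on F (taylor_coef F z0) z0 rho.
Proof.
move=> /hF[a [rho [rho0 Fa]]]; exists rho => //.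
have Fa' : power_series_on F a z0 rho by [].
by rewrite (taylor_coef_power_series rho0 Fa').
Qed.

Lemma expands_line z0 w : unit_ball z0 ->
  expands (fun x => F (z0 + x *: w)) (fun k => hpoly (taylor_coef F z0) k (w 0)).
Proof. by move=> /taylor_power_series[rho rho0]; exact: power_series_expands. Qed.

Lemma jet2_line z0 w t : unit_ball (z0 + t *: w) ->
  jet2 (fun x => F (z0 + x *: w)) t.
Proof.
move=> /(expands_line w) Fe; apply: expands_jet2; apply: expands_eq Fe => // h.
by rewrite scalerDl addrA.
Qed.

(** The slice of the ball in direction [w] contains a disc of radius above 1,
as [taylor_at1] requires. *)
Definition admissible z0 w : Prop :=
  exists2 s : R, 1 < s & forall t, cmod t <= s -> unit_ball (z0 + t *: w).

Lemma taylor_cvg z0 w : unit_ball z0 -> admissible z0 w ->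
  series (fun k => hpoly (taylor_coef F z0) k (w 0)) @ \oo --> F (z0 + w).
Proof.
move=> z0B [s s1 sB]; apply/cvgC => e e0.
have fj t : cmod t <= s -> jet2 (fun x => F (z0 + x *: w)) t.
  by move=> /sB; exact: jet2_line.
have := taylor_at1 s1 fj (expands_line w z0B) e0.
by rewrite scale1r.
Qed.

(** Slices and [cauchy_bound] bound each homogeneous part of degree other than
[k0] on the torus; [poly_coef_bound] then separates its monomials. With
[e = 1] the part of degree [k0] is removed, as in the definition of a
dominating polynomial, and [e = 0] gives the usual inequality. *)
Lemma cauchy_estimate z0 (rho : 'I_n -> R) (e : C) k0 (B : R) :
  unit_ball z0 -> (forall j, 0 <= rho j) ->
  (forall w, (forall j, cmod (w 0 j) = rho j) -> admissible z0 w /\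
     cmod (F (z0 + w) - e * hpoly (taylor_coef F z0) k0 (w 0)) <= B) ->
  forall J, mdeg J != k0 -> cmod (taylor_coef F z0 J) * mpow rho J <= B.
Proof.
move=> z0B rho0 FB J Jk0; set b := taylor_coef F z0.
apply: (poly_coef_bound (k := mdeg J)) => // v vrho.
pose w : 'rV[C]_n := \row_j v j.
have wE : w 0 = v by apply/funext => j; rewrite mxE.
have cw t : cmod t = 1 -> forall j, cmod ((t *: w) 0 j) = rho j.
  by move=> t1 j; rewrite mxE cmodM t1 mul1r wE.
pose f x := F (z0 + x *: w) - e * hpoly b k0 (w 0) * x ^+ k0.
have fe : expands f (fun k => hpoly b k (w 0) -
    (if k == k0 then e * hpoly b k0 (w 0) else 0)).
  exact: expandsB (expands_line w z0B) (expands_monomial _ _).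
have w1 j : cmod (w 0 j) = rho j by rewrite wE.
have [[s s1 sB] _] := FB _ w1.
have fj t : cmod t <= 1 -> jet2 f t.
  move=> t1; apply: jet2D.
    by apply: jet2_line; apply: sB; rewrite (le_trans t1)// ltW.
  apply: (@jet2_eq _ (fun x => - (e * hpoly b k0 (w 0)) * x ^+ k0)).
    by move=> x; rewrite mulNr.
  apply: jet2M; first exact: jet2_cst.
  by apply: jet2X; exact: jet2_id.
have fB t : cmod t = 1 -> cmod (f t) <= B.
  move=> t1; have [_] := FB _ (cw _ t1).
  have -> : hpoly b k0 ((t *: w) 0) = t ^+ k0 * hpoly b k0 (w 0).
    by rewrite -hpolyZ; congr (hpoly _ _ _); apply/funext => j; rewrite mxE.
  by rewrite /f mulrCA [_ * t ^+ k0]mulrC.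
have := cauchy_bound (mdeg J) ltr01 fj fe fB.
by rewrite (negbTE Jk0) subr0 expr1n mulr1 wE.
Qed.

End Analytic.
End AnalyticLines.

(** * Propagation of coefficient bounds across a polydisc *)

Section Growth.
Variables (R : realType) (n : nat).
Local Notation C := (Cx R).
Variables (F : 'rV[C]_n -> C) (L : 'rV[C]_n -> 'I_n -> R) (hF : analytic_on_ball F).
Variables (s La eta : R) (p : nat).
Hypotheses (s1 : 1 < s) (La1 : 1 <= La) (eta0 : 0 < eta) (eta1 : eta <= 1).
Hypothesis Lgt0 : forall (z : 'rV[C]_n) j, unit_ball z -> 0 < L z j.
Hypothesis Ladm : forall z w : 'rV[C]_n, unit_ball z ->
  (forall j, cmod (w 0 j) * L z j <= s) -> admissible z w.
Hypothesis Lcmp : forall z0 z : 'rV[C]_n, unit_ball z0 ->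
  (forall j, cmod (z 0 j - z0 0 j) * L z0 j <= s) ->
  forall j, L z j <= La * L z0 j /\ L z0 j <= La * L z j.
Local Notation b := (taylor_coef F).
Hypothesis Fdom : forall (z : 'rV[C]_n) (A : R), unit_ball z ->
  (forall K, (mdeg K <= p)%N -> cmod (b z K) <= A * mpow (L z) K) ->
  forall J, cmod (b z J) <= A * eta^-1 ^+ mdeg J * mpow (L z) J.
Implicit Types (z w v : 'rV[C]_n).

Lemma admissible_ball z w : admissible z w -> unit_ball (z + w).
Proof. by move=> [q q1 /(_ 1)]; rewrite cmod1 scale1r; apply; exact: ltW. Qed.

Lemma polydisc_ball z0 z : unit_ball z0 ->
  (forall j, cmod (z 0 j - z0 0 j) * L z0 j <= s) -> unit_ball z.
Proof.
move=> z0B zz0; rewrite -(subrK z0 z) addrC; apply: admissible_ball.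
by apply: Ladm => // j; rewrite !mxE.
Qed.

Lemma taylor_coef0 z : unit_ball z -> F z = b z (fun=> 0%N).
Proof. by move=> /(taylor_power_series hF)[rho rho0]; exact: power_series_center. Qed.

(** Relative distance between consecutive points of the chain, chosen so that the
geometric series in [growth_near] has ratio 1/2. *)
Definition chain_step : R := eta / (4 * 2 ^+ n * La).

Lemma La_gt0 : 0 < La. Proof. exact: lt_le_trans La1. Qed.
Hint Resolve La_gt0 : core.

Lemma chain_step_gt0 : 0 < chain_step.
Proof. by rewrite divr_gt0// !mulr_gt0// exprn_gt0. Qed.
Hint Resolve chain_step_gt0 : core.

Lemma chain_stepE : 2 ^+ n * (La / eta * (2 * chain_step)) = 2^-1.
Proof. by rewrite /chain_step; field; rewrite !gt_eqF// exprn_gt0. Qed.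

Lemma chain_stepLa : 2 * chain_step * La <= 1.
Proof.
have -> : 2 * chain_step * La = eta / (2 * 2 ^+ n).
  by rewrite /chain_step; field; rewrite !gt_eqF// exprn_gt0.
rewrite ler_pdivrMr ?mulr_gt0 ?exprn_gt0// mul1r (le_trans eta1)//.
by have := @exprn_ege1 R n 2 ltac:(lra); lra.
Qed.

Lemma chain_step_le1 : chain_step <= 1.
Proof.
have := chain_stepLa; have : chain_step * 1 <= chain_step * La by rewrite ler_wpM2l// ltW.
have := chain_step_gt0; lra.
Qed.

Section FixedCenter.
Variables (z0 : 'rV[C]_n) (z0B : unit_ball z0).

(** The closed polydisc about [z0] with radii [s / L z0], where [L] is comparable
to [L z0]. *)
Definition near0 (z : 'rV[C]_n) := forall j, cmod (z 0 j - z0 0 j) * L z0 j <= s.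
(** The coefficients of low degree at [z] are measured with the weight of the
centre [z0], so that bounds at different points can be compared. *)
Definition coef_bound (z : 'rV[C]_n) (H : R) :=
  forall K, (mdeg K <= p)%N -> cmod (b z K) <= H * mpow (L z0) K.

Lemma coef_bound_ge0 z H : coef_bound z H -> 0 <= H.
Proof.
move=> /(_ (fun=> 0%N)); rewrite {1}/mdeg big1// => /(_ isT).
by rewrite /mpow big1 ?mulr1// => /(le_trans (cmod_ge0 _)).
Qed.

(** The hypothesis [Fdom] at [z] with the weights [L z] and [L z0] exchanged at
the cost of powers of [La]; the bounds for low degrees then control all
degrees. *)
Lemma coef_growth z H : near0 z -> coef_bound z H ->
  forall J, cmod (b z J) <= H * La ^+ p * (La / eta) ^+ mdeg J * mpow (L z0) J.
Proof.
move=> zn zH J; have zB := polydisc_ball z0B zn.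
have H0 := coef_bound_ge0 zH.
have Lz j := Lcmp z0B zn j.
have zH' K : (mdeg K <= p)%N -> cmod (b z K) <= H * La ^+ p * mpow (L z) K.
  move=> Kp; apply: le_trans (zH K Kp) _; rewrite -mulrA ler_wpM2l//.
  apply: (@le_trans _ _ (mpow (fun j => La * L z j) K)).
    by apply: le_mpow => j; rewrite (ltW (Lgt0 _ z0B)) (Lz j).2.
  rewrite mpowM mpow_cst ler_wpM2r ?ler_weXn2l//.
  by apply: mpow_ge0 => j; rewrite ltW// Lgt0.
apply: le_trans (Fdom zB zH' J) _.
rewrite expr_div_n -!mulrA ler_wpM2l// ler_wpM2l ?exprn_ge0 ?(ltW La_gt0)//.
rewrite [leRHS]mulrCA exprVn ler_wpM2l ?invr_ge0 ?exprn_ge0 ?(ltW eta0)//.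
rewrite -mpow_cst -mpowM; apply: le_mpow => j.
by rewrite (ltW (Lgt0 _ zB)) (Lz j).1.
Qed.

(** The coefficients at [z] grow at most geometrically, so the Taylor series at [z]
is summable on a small polydisc and bounds [F] there. *)
Lemma growth_near z H v : near0 z -> coef_bound z H ->
  (forall j, cmod (v 0 j) * L z0 j <= 2 * chain_step) ->
  cmod (F (z + v)) <= 2 * La ^+ p * H.
Proof.
move=> zn zH vs; have zB := polydisc_ball z0B zn.
have H0 := coef_bound_ge0 zH.
have adm : admissible z v.
  apply: Ladm => // j.
  apply: (@le_trans _ _ (cmod (v 0 j) * (La * L z0 j))).
    by rewrite ler_wpM2l// (Lcmp z0B zn j).1.
  rewrite mulrCA; apply: (@le_trans _ _ (La * (2 * chain_step))).
    by rewrite ler_wpM2l// ltW.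
  by rewrite mulrC (le_trans chain_stepLa)// ltW.
have HLa : 0 <= H * La ^+ p by rewrite mulr_ge0// exprn_ge0// ltW.
have Pk k : cmod (hpoly (b z) k (v 0)) <= 2^-1 ^+ k * (H * La ^+ p).
  apply: le_trans (cmod_hpoly _ _ _) _.
  have q0 : 0 <= La / eta * (2 * chain_step).
    by rewrite ltW// mulr_gt0// ?divr_gt0// mulr_gt0.
  rewrite -chain_stepE exprMn -[leRHS]mulrA; apply: hpoly_le_card.
    by rewrite mulr_ge0// exprn_ge0.
  move=> J Jk.
  have vJ : mpow (L z0) J * mpow (fun j => cmod (v 0 j)) J <= (2 * chain_step) ^+ k.
    rewrite -mpowM -Jk -mpow_cst; apply: le_mpow => j.
    by rewrite mulrC vs mulr_ge0// ltW// Lgt0.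
  apply: le_trans (ler_wpM2r _ (coef_growth zn zH J)) _; first exact: mpow_ge0.
  rewrite Jk -[leLHS]mulrA.
  have -> : (La / eta * (2 * chain_step)) ^+ k * (H * La ^+ p) =
      H * La ^+ p * (La / eta) ^+ k * (2 * chain_step) ^+ k by rewrite exprMn; ring.
  rewrite ler_wpM2l// mulr_ge0// exprn_ge0// divr_ge0// ltW//.
rewrite -[F (z + v)]subr0.
apply: (cmod_lim_dist_le (m0 := 0%N) (taylor_cvg hF zB adm)) => m _.
rewrite subr0 /series /=; apply: le_trans (cmod_sum _ _ _) _.
apply: le_trans (ler_sum _ (fun k _ => Pk k)) _.
rewrite -mulr_suml -mulrA [La ^+ p * H]mulrC ler_wpM2r//.
elim: m => [|m IH]; first by rewrite big_geq.
rewrite big_nat_recl//= expr0.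
have -> : \sum_(0 <= i < m) 2^-1 ^+ i.+1 = 2^-1 * \sum_(0 <= i < m) (2^-1 : R) ^+ i.
  by rewrite mulr_sumr; apply: eq_bigr => i _; rewrite exprS.
lra.
Qed.

(** The loss in one step of the chain: the bound of [growth_near] divided by the
radius to the power of the highest degree, [p]. *)
Definition chain_factor : R := 2 * La ^+ p * chain_step ^- p.

Lemma chain_factor_ge0 : 0 <= chain_factor.
Proof. by rewrite !mulr_ge0 ?invr_ge0 ?exprn_ge0 ?(ltW La_gt0) ?(ltW chain_step_gt0). Qed.

(** The polydisc of radii [chain_step / L z0] about [z'] lies in the one of twice
these radii about [z], where [growth_near] bounds [F]; Cauchy's inequality at
[z'] turns this back into a bound of coefficients. *)
Lemma coef_bound_step z z' H : near0 z -> near0 z' ->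
  (forall j, cmod (z' 0 j - z 0 j) * L z0 j <= chain_step) ->
  coef_bound z H -> coef_bound z' (chain_factor * H).
Proof.
move=> zn zn' zz' zH K Kp; have zB' := polydisc_ball z0B zn'.
have H0 := coef_bound_ge0 zH.
pose rho j := chain_step / L z0 j.
have Lz0 j : 0 < L z0 j by exact: Lgt0.
have rho0 j : 0 <= rho j by rewrite divr_ge0// ltW.
have := @cauchy_estimate _ _ _ hF z' rho 0 (mdeg K).+1 (2 * La ^+ p * H) zB' rho0.
have HK : mdeg K != (mdeg K).+1 by rewrite ltn_eqF.
move=> /(_ _ K HK) hK.
have {hK} : cmod (b z' K) * mpow rho K <= 2 * La ^+ p * H.
  apply: hK => w wrho; split.
    apply: Ladm => // j; rewrite wrho /rho.
    apply: (@le_trans _ _ (chain_step / L z0 j * (La * L z0 j))).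
      by apply: ler_wpM2l; [exact: rho0|exact: (Lcmp z0B zn' j).1].
    have -> : chain_step / L z0 j * (La * L z0 j) = chain_step * La.
      by field; rewrite gt_eqF.
    have := chain_stepLa; have : 0 <= chain_step * La by rewrite mulr_ge0// ltW.
    by move: s1; lra.
  rewrite mul0r subr0 -(subrK z z') -addrA addrC -addrA.
  rewrite [w + _]addrC; apply: growth_near => // j.
  rewrite !mxE; apply: (@le_trans _ _ ((cmod (z' 0 j - z 0 j) + cmod (w 0 j)) * L z0 j)).
    by rewrite ler_wpM2r ?cmodD// ltW.
  rewrite mulrDl wrho /rho divfK ?gt_eqF//; have := zz' j; lra.
rewrite /rho mpowM mpow_cst mpowV.
have LK : 0 < mpow (L z0) K by exact: mpow_gt0.
rewrite mulrA ler_pdivrMr// => bK.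
rewrite -(ler_pM2r (exprn_gt0 p chain_step_gt0)).
have -> : chain_factor * H * mpow (L z0) K * chain_step ^+ p =
    2 * La ^+ p * H * mpow (L z0) K.
  by rewrite /chain_factor; field; rewrite expf_neq0// gt_eqF.
apply: le_trans bK; rewrite ler_wpM2l//.
by rewrite ler_wiXn2l ?chain_step_le1// ltW.
Qed.

Lemma near0_segment z (t : R) : near0 z -> 0 <= t <= 1 ->
  near0 (z0 + ofreal t *: (z - z0)).
Proof.
move=> zn /andP[t0 t1] j; rewrite !mxE addrAC subrr add0r cmodM cmod_ofreal ger0_norm//.
by rewrite -mulrA (le_trans _ (zn j))// ler_piMl// mulr_ge0// ltW// Lgt0.
Qed.

(** A chain of [N + 1] equal steps along the segment from [z0] to [z]. The number
of steps does not depend on [z0]. *)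
Lemma coef_bound_near0 z H N : near0 z -> s <= N.+1%:R * chain_step ->
  coef_bound z0 H -> coef_bound z (chain_factor ^+ N.+1 * H).
Proof.
move=> zn sN zH.
have N0 : 0 < N.+1%:R :> R by rewrite ltr0n.
have t01 i : (i <= N.+1)%N -> 0 <= (i%:R / N.+1%:R : R) <= 1.
  by move=> iN; rewrite divr_ge0//= ler_pdivrMr// mul1r ler_nat.
pose y i := z0 + ofreal (i%:R / N.+1%:R) *: (z - z0).
have yn i : (i <= N.+1)%N -> near0 (y i) by move=> /t01; exact: near0_segment.
have yH i : (i <= N.+1)%N -> coef_bound (y i) (chain_factor ^+ i * H).
  elim: i => [_|i IH iN].
    by rewrite expr0 mul1r /y mul0r scale0r addr0.
  rewrite exprS -mulrA; apply: coef_bound_step (IH (ltnW iN)).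
  - exact: yn (ltnW iN).
  - exact: yn.
  - move=> j; rewrite !mxE.
    have -> : z0 0 j + ofreal (i.+1%:R / N.+1%:R) * (z 0 j - z0 0 j) -
       (z0 0 j + ofreal (i%:R / N.+1%:R) * (z 0 j - z0 0 j)) =
       ofreal (N.+1%:R^-1) * (z 0 j - z0 0 j).
      rewrite -[i.+1]addn1 natrD mulrDl ofrealD mul1r; ring.
    rewrite cmodM cmod_ofreal ger0_norm ?invr_ge0// -mulrA ler_pdivrMl//.
    exact: le_trans (zn j) _.
have := yH N.+1 (leqnn _); rewrite /y divff ?gt_eqF//.
by rewrite -[ofreal 1]/(1 : C) scale1r addrC subrK.
Qed.

(** Since [F z] is the coefficient of index 0, the chain bounds [F] on the whole
polydisc of radii [s / L z0], and Cauchy's inequality there gains the factor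
[s ^ mdeg J]. *)
Lemma coef_decay H N : s <= N.+1%:R * chain_step -> coef_bound z0 H ->
  forall J, cmod (b z0 J) * s ^+ mdeg J <= chain_factor ^+ N.+1 * H * mpow (L z0) J.
Proof.
move=> sN zH J; have s0 : 0 < s by rewrite (lt_trans _ s1).
pose rho j := s / L z0 j.
have Lz0 j : 0 < L z0 j by exact: Lgt0.
have rho0 j : 0 <= rho j by rewrite divr_ge0// ltW.
have JS : mdeg J != (mdeg J).+1 by rewrite ltn_eqF.
have := @cauchy_estimate _ _ _ hF z0 rho 0 (mdeg J).+1 (chain_factor ^+ N.+1 * H) z0B rho0.
move=> /(_ _ J JS) hJ.
have {hJ} : cmod (b z0 J) * mpow rho J <= chain_factor ^+ N.+1 * H.
  apply: hJ => w wrho.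
  have ws j : cmod (w 0 j) * L z0 j <= s by rewrite wrho /rho divfK// gt_eqF.
  have wn : near0 (z0 + w) by move=> j; rewrite !mxE addrAC subrr add0r.
  have adm : admissible z0 w by exact: Ladm.
  split=> //; rewrite mul0r subr0 (taylor_coef0 (admissible_ball adm)).
  have := coef_bound_near0 wn sN zH (K := fun=> 0%N).
  by rewrite {1}/mdeg big1// => /(_ isT); rewrite /mpow big1 ?mulr1.
rewrite /rho mpowM mpow_cst mpowV.
have LJ : 0 < mpow (L z0) J by exact: mpow_gt0.
by rewrite mulrA ler_pdivrMr.
Qed.

End FixedCenter.
End Growth.

(** * From dominating polynomials to bounded index *)

Section Assembly.
Variables (R : realType) (n : nat).
Local Notation C := (Cx R).
Implicit Types (F : 'rV[C]_n -> C) (L : 'rV[C]_n -> 'I_n -> R) (z w : 'rV[C]_n).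

(** On the skeleton the series without the term of index [k0] sums to [F] minus
its homogeneous part, because the Taylor series converges there. Cauchy's
inequality bounds the coefficients of all other degrees by [A]. *)
Lemma dominating_coef_bound F z (rho : 'I_n -> R) k0 (A : R) :
  analytic_on_ball F -> unit_ball z -> (forall j, 0 <= rho j) -> 0 <= A ->
  (forall w, (forall j, cmod (w 0 j) = rho j) -> admissible z w) ->
  dominating F z rho k0 ->
  (forall K, mdeg K = k0 -> cmod (taylor_coef F z K) * mpow rho K <= A) ->
  forall J, cmod (taylor_coef F z J) * mpow rho J <= A.
Proof.
move=> hF zB rho0 A0 adm dom AK J; set b := taylor_coef F z in AK *.
have [Jk0|Jk0] := eqVneq (mdeg J) k0; first exact: AK.
apply: (cauchy_estimate hF (k0 := k0) (e := 1)) => // w wrho.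
split; first exact: adm.
have [|s [sl sle]] := dom (z + w).
  by move=> j; rewrite !mxE addrAC subrr add0r.
have wE : z + w - z = w by rewrite addrAC subrr add0r.
rewrite wE in sl.
have Fl := taylor_cvg hF zB (adm _ wrho).
suff E : s = F (z + w) - 1 * hpoly b k0 (w 0).
  rewrite -E; apply: (le_trans sle).
  apply: (@le_trans _ _ (2^-1 * A)); last by lra.
  by rewrite ler_wpM2l//; apply: bigmax_le => // K /eqP; exact: AK.
apply: (cvgC_unique sl); apply/cvgC => e e0.
move/cvgC : Fl => /(_ e e0)[N hN].
exists (maxn N k0.+1) => m; rewrite geq_max => /andP[Nm km].
have := hN m Nm; rewrite /series /= !(bigD1_seq k0) ?mem_index_iota ?iota_uniq//=.
rewrite eqxx add0r mul1r opprB addrA [X in cmod (X - _)]addrC.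
by rewrite [in X in _ -> X](eq_bigr (fun k => hpoly b k (w 0))) // => k /negbTE->.
Qed.

(** The radii [r j] lie between [eta] and 1: the upper bound makes the right-hand
side of [dominating_coef_bound] at most [A], and the lower one makes the
left-hand side at least the coefficient times [(eta / L) ^ J]. *)
Lemma low_coefs_control F L z (r : 'I_n -> R) (d eta A : R) k0 p :
  analytic_on_ball F -> unit_ball z -> (forall j, 0 < L z j) ->
  (forall w, (forall j, cmod (w 0 j) * L z j <= 1) -> admissible z w) ->
  0 < eta -> d <= 1 -> (forall j, eta < r j /\ r j < d) -> (k0 <= p)%N ->
  dominating F z (fun j => r j / L z j) k0 ->
  (forall K, (mdeg K <= p)%N -> cmod (taylor_coef F z K) <= A * mpow (L z) K) ->
  forall J, cmod (taylor_coef F z J) <= A * eta^-1 ^+ mdeg J * mpow (L z) J.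
Proof.
move=> hF zB Lz adm eta0 d1 rd k0p zdom AK J.
have A0 : 0 <= A.
  have := AK (fun=> 0%N); rewrite {1}/mdeg big1// => /(_ isT).
  by rewrite /mpow big1 ?mulr1// => /(le_trans (cmod_ge0 _)).
have r0 j : 0 < r j by exact: lt_trans eta0 (rd j).1.
have rho0 j : 0 <= r j / L z j by rewrite divr_ge0// ltW.
have LJ K : 0 < mpow (L z) K by exact: mpow_gt0.
have rhoE K : mpow (fun j => r j / L z j) K = mpow r K / mpow (L z) K.
  by rewrite mpowM mpowV.
have := @dominating_coef_bound F z _ k0 A hF zB rho0 A0 _ zdom _ J.
rewrite rhoE mulrA ler_pdivrMr// => bJ.
have {}bJ : cmod (taylor_coef F z J) * mpow r J <= A * mpow (L z) J.
  apply: bJ => [w wrho|K Kk0].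
    apply: adm => j; rewrite wrho divfK ?gt_eqF//.
    by have := (rd j).2; move: d1; lra.
  rewrite rhoE mulrA ler_pdivrMr//.
  apply: le_trans (_ : cmod (taylor_coef F z K) * 1 <= _); last first.
    by rewrite mulr1 AK// Kk0.
  rewrite ler_wpM2l// -(expr1n _ (mdeg K)) -mpow_cst; apply: le_mpow => j.
  by rewrite ltW//=; have := (rd j).2; lra.
rewrite mulrAC exprVn ler_pdivlMr ?exprn_gt0//.
apply: le_trans bJ; rewrite ler_wpM2l// -mpow_cst; apply: le_mpow => j.
by rewrite (ltW eta0) ltW// (rd j).1.
Qed.

(** The infima and suprema of the finitely many ratios combine into one constant. *)
Lemma classQ_ratio (beta : R) L (r : 'I_n -> R) : 0 < beta -> classQ beta L ->
  (forall i, 0 <= r i) -> enormR r <= beta ->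
  exists2 La : R, 1 <= La & forall z0 z, unit_ball z0 ->
    polydisc z0 (fun i => r i / L z0 i) z ->
    forall j, L z j <= La * L z0 j /\ L z0 j <= La * L z j.
Proof.
move=> beta0 [_ _ Lb Q] r0 rb.
have L0 z j : unit_ball z -> 0 < L z j.
  move=> zB; apply: le_lt_trans (Lb j z zB).
  by rewrite divr_ge0 ?ltW// subr_gt0.
have M j : exists M : R, 1 <= M /\ forall q, ratios L j r q -> q <= M /\ 1 <= M * q.
  have [l0 [_ l2]] := Q r r0 rb j.
  have [l l0' ql] : exists2 l : R, 0 < l & forall q, ratios L j r q -> l <= q.
    have lq q : ratios L j r q -> (lambda1 L j r <= q%:E)%E.
      by move=> rq; apply: ereal_inf_lbound; exists q.
    case: (lambda1 L j r) l0 lq => [l||//] l0 lq.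
      by exists l => // q /lq; rewrite lee_fin.
    by exists 1 => // q /lq.
  have [u qu] : exists u : R, forall q, ratios L j r q -> q <= u.
    have uq q : ratios L j r q -> (q%:E <= lambda2 L j r)%E.
      by move=> rq; apply: ereal_sup_ubound; exists q.
    case: (lambda2 L j r) l2 uq => [u||] // l2 uq.
      by exists u => q /uq; rewrite lee_fin.
    by exists 1 => q /uq.
  exists (1 + `|u| + l^-1); have li : 0 < l^-1 by rewrite invr_gt0.
  split; first by rewrite -addrA lerDl addr_ge0// ltW.
  move=> q rq; split; first by have := qu q rq; have := ler_norm u; lra.
  have lq := ql q rq; rewrite -ler_pdivrMr; last exact: lt_le_trans lq.
  rewrite mul1r (@le_trans _ _ l^-1)//; last by rewrite lerDr addr_ge0.
  by rewrite lef_pV2// posrE (lt_le_trans l0').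
have [f fM] := choice M.
pose La := 1 + \sum_j f j.
have f0 j : 0 <= f j by have [h _] := fM j; rewrite (le_trans _ h).
have fLa j : f j <= La.
  rewrite /La (bigD1 j)//= addrCA lerDl addr_ge0// sumr_ge0// => i _.
exists La; first by rewrite lerDl sumr_ge0.
move=> z0 z z0B zz0 j.
have Lz0 := L0 z0 j z0B.
have [_ /(_ (L z j / L z0 j)) []] := fM j; first by exists z0, z.
rewrite ler_pdivrMr// mulrA ler_pdivlMr// mul1r => h1 h2.
split; first by rewrite (le_trans h1)// ler_wpM2r// ltW.
have Lz : 0 < L z j by rewrite -(pmulr_rgt0 _ (lt_le_trans ltr01 (fM j).1)) (lt_le_trans Lz0).
by rewrite (le_trans h2)// ler_wpM2r// ltW.
Qed.

Lemma index_termE L F z K :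
  index_term L F z K = cmod (taylor_coef F z K) / mpow (L z) K.
Proof. by rewrite /index_term /taylor_coef cmodf cmod_nat invfM mulrA. Qed.

Lemma index_term_le_max L F z m J : (mdeg J <= m)%N ->
  index_term L F z J <=
  \big[Num.max/0]_(K : {ffun 'I_n -> 'I_m.+1} | (mdeg (midx K) <= m)%N)
         index_term L F z (midx K).
Proof.
move=> Jm; have [K KJ] := midx_exists Jm; rewrite -KJ.
by apply: (le_bigmax_cond _ (fun K => index_term L F z (midx K))); rewrite KJ.
Qed.

End Assembly.

Theorem theorem12 (R : realType) (n : nat) (beta : R)
    (hbeta : Num.sqrt (n%:R : R) < beta)
    (L : 'rV[Cx R]_n -> 'I_n -> R) (hL : classQ beta L)
    (F : 'rV[Cx R]_n -> Cx R) (hF : analytic_on_ball F)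
    (hdom : exists (p : nat) (d eta : R),
       [/\ 0 < d, d <= 1, 0 < eta & eta < d] /\
       forall z0 : 'rV[Cx R]_n, @unit_ball R n z0 ->
       exists (r : 'I_n -> R) (k0 : nat),
         [/\ forall j, eta < r j /\ r j < d,
             (k0 <= p)%N &
             dominating F z0 (fun j => r j / L z0 j) k0]) :
  bounded_L_index L F.
Proof.
(* With no coordinates the only multi-index has degree 0; below, [Num.sqrt n] has
   to be nonzero. *)
have [n0|n0] := posnP n.
  exists 0%N => z _ J; apply: index_term_le_max.
  by rewrite /mdeg big1// => j _; have := ltn_ord j; rewrite {2}n0.
have sn0 : 0 < Num.sqrt (n%:R : R) by rewrite sqrtr_gt0 ltr0n.
have beta0 : 0 < beta by exact: lt_trans hbeta.
(* The largest common radius that the class Q allows; it exceeds 1. *)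
pose s := beta / Num.sqrt (n%:R : R).
have s1 : 1 < s by rewrite ltr_pdivlMr// mul1r.
have s0 : 0 < s by exact: lt_trans s1.
have sb : enormR (fun _ : 'I_n => s) <= beta.
  rewrite /enormR sumr_const card_ord -[X in Num.sqrt X]mulr_natr.
  by rewrite sqrtrM ?sqr_ge0// sqrtr_sqr gtr0_norm// divfK// gt_eqF.
have [La La1 Lratio] := classQ_ratio beta0 hL (fun=> ltW s0) sb.
have [_ _ Lb _] := hL.
have Lgt0 (z : 'rV[Cx R]_n) j : unit_ball z -> 0 < L z j.
  move=> zB; apply: le_lt_trans (Lb j z zB).
  by rewrite divr_ge0 ?ltW// subr_gt0.
have Ladm (z w : 'rV[Cx R]_n) : unit_ball z ->
    (forall j, cmod (w 0 j) * L z j <= s) -> admissible z w.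
  move=> zB ws; apply: ball_slack => // j.
  have k0 : 0 < 1 - enormC z by rewrite subr_gt0.
  have := ws j; rewrite -ler_pdivlMr ?Lgt0// => wj.
  apply: (@le_lt_trans _ _ (beta / L z j)).
    have -> : beta / L z j = Num.sqrt n%:R * (s / L z j).
      by rewrite /s; field; rewrite !gt_eqF// Lgt0.
    by rewrite ler_wpM2l// ltW.
  by rewrite ltr_pdivrMr ?Lgt0// mulrC -ltr_pdivrMr// Lb.
have Lcmp (z0 z : 'rV[Cx R]_n) : unit_ball z0 ->
    (forall j, cmod (z 0 j - z0 0 j) * L z0 j <= s) ->
    forall j, L z j <= La * L z0 j /\ L z0 j <= La * L z j.
  by move=> z0B zz0; apply: Lratio => // j; rewrite ler_pdivlMr ?Lgt0.
move: hdom => [p [d [eta [[d0 d1 eta0 etad] dom]]]].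
have Fdom (z : 'rV[Cx R]_n) (A : R) : unit_ball z ->
    (forall K, (mdeg K <= p)%N ->
      cmod (taylor_coef F z K) <= A * mpow (L z) K) ->
    forall J, cmod (taylor_coef F z J) <= A * eta^-1 ^+ mdeg J * mpow (L z) J.
  move=> zB; have [r [k0 [rd k0p zdom]]] := dom z zB.
  apply: (low_coefs_control hF zB _ _ eta0 d1 rd k0p zdom) => [j|w w1].
    exact: Lgt0.
  by apply: Ladm => // j; rewrite (le_trans (w1 j))// ltW.
have eta1 : eta <= 1 by rewrite ltW// (lt_le_trans etad).
pose st := chain_step n La eta.
have st0 : 0 < st by exact: chain_step_gt0.
pose N := Num.bound (s / st).
have sN : s <= N.+1%:R * st.
  rewrite -ler_pdivrMr//; have : s / st < N%:R.
    by rewrite archi_boundP// divr_ge0// ltW.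
  by rewrite -[N.+1]addn1 natrD; lra.
pose G := chain_factor n La eta p ^+ N.+1.
have G0 : 0 <= G by rewrite exprn_ge0// chain_factor_ge0.
(* From degree [m0] on, the gain [s ^ mdeg J] outweighs the loss [G]. *)
have [m0 hm0] := linear_le_expr s1 G0 ltr01.
exists (maxn p m0) => z zB J.
have [Jm|mJ] := leqP (mdeg J) (maxn p m0); first exact: index_term_le_max.
set H := (X in _ <= X).
have LJ K : 0 < mpow (L z) K by apply: mpow_gt0 => j; exact: Lgt0.
have zH : coef_bound F L p z z H.
  move=> K Kp; rewrite -ler_pdivrMr// -index_termE; apply: index_term_le_max.
  by rewrite (leq_trans Kp)// leq_maxl.
have H0 := coef_bound_ge0 zH.
have := coef_decay hF s1 La1 eta0 eta1 Lgt0 Ladm Lcmp Fdom zB sN zH J.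
rewrite -/G => hJ; rewrite index_termE ler_pdivrMr//.
have sJ : 0 < s ^+ mdeg J by rewrite exprn_gt0.
rewrite -(ler_pM2r sJ); apply: (le_trans hJ).
have -> : H * mpow (L z) J * s ^+ mdeg J = s ^+ mdeg J * H * mpow (L z) J.
  by rewrite mulrAC [H * _]mulrC.
rewrite ler_wpM2r ?(ltW (LJ J))// ler_wpM2r//.
have := hm0 (mdeg J) (leq_trans (leq_maxr _ _) (ltnW mJ)); rewrite mul1r => /ltW.
by apply: le_trans; rewrite ler_peMl// ler1n.
Qed.
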